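(* In the setting of the context, let $0\le t\le\tau\le T$ and assume that $\rho_\tau$ is selected such that $W^{\mathsf P}_s$ is Brownian on the interval $[t,\tau]$ with respect to the induced measure $\mathsf R_\tau$. Then $$Y_t=\mathbf{E}_{\mathsf R_\tau}\big[\widehat Y_{t,\tau}\,\big|\,X_t\big]=V^\mu(t,X_t)\qquad \mathsf R_\tau\text{-a.s.},$$ where $\widehat Y_{t,\tau}:=Y_\tau+\int_t^\tau(\ell^\mu_s+Z_s^\top D_s)\,\mathrm{d}s$. Furthermore, the minimizer $\phi^*$ of the optimization problem $$\inf_{\phi\in L^2}\mathbf{E}_{\mathsf R_\tau}\big[(\widehat Y_{t,\tau}-\phi(X_t))^2\big]=\inf_{\phi\in L^2}\mathbf{E}_{\mathsf P_\tau}\big[\Theta^{\mathsf R|\mathsf P}_\tau\,(\widehat Y_{t,\tau}-\phi(X_t))^2\big]$$ over $X_t$-measurable square-integrable random variables $\phi(X_t)$ coincides with the value function: $\phi^*(X_t)=V^\mu(t,X_t)$.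
   Context: Setting. $T>0$; $(\Omega,\mathcal{F},\{\mathcal{F}_s\}_{s\in[0,T]},\mathsf P)$ is a complete filtered probability space carrying an $n$-dimensional standard Brownian motion $W^{\mathsf P}_s$. $U\subseteq\mathbb{R}^m$ is compact. The data are $f:[0,T]\times\mathbb{R}^n\times U\to\mathbb{R}^n$, $\sigma:[0,T]\times\mathbb{R}^n\to\mathbb{R}^{n\times n}$, $\ell:[0,T]\times\mathbb{R}^n\times U\to\mathbb{R}_+$, $g:\mathbb{R}^n\to\mathbb{R}_+$, and a policy $\mu:[0,T]\times\mathbb{R}^n\times\mathbb{R}^n\to U$. Define $$h^\mu(t,x,z):=\ell(t,x,\mu(t,x,z))+z^\top\sigma^{-1}(t,x)f(t,x,\mu(t,x,z)),$$ and the Hamilton-Jacobi PDE $$\text{(HJ)}\qquad \partial_tV^\mu+\tfrac12\operatorname{tr}[\sigma\sigma^\top\partial_{xx}V^\mu]+h^\mu(t,x,\sigma^\top\partial_xV^\mu)=0,\qquad V^\mu(T,x)=g(x).$$ Standing conditions. (A1) $f,\sigma,\ell,g$ are uniformly continuous and Lipschitz in $x$ for all $(t,u)\in[0,T]\times U$ (uniformly); $\sigma$ has sublinear growth in $x$ and $g$ has polynomial growth in $x$; $\sigma^{-1}$ exists and is bounded. (A2) $h^\mu$ is uniformly continuous in $(t,x)$, Lipschitz in $z$, and has polynomial growth in $x$. (A3) (HJ) admits a classical solution $V^\mu$, i.e. continuously differentiable in $t$ and twice continuously differentiable in $x$. Notation: $\mu(t,x):=\mu(t,x,\sigma^\top(t,x)\partial_xV^\mu(t,x))$,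 $f^\mu(t,x):=f(t,x,\mu(t,x))$, $\ell^\mu(t,x):=\ell(t,x,\mu(t,x))$. Drifted FBSDE. $x_0\in\mathbb{R}^n$ and $K_s$ is an $\mathcal{F}_s$-progressively measurable $\mathbb{R}^n$-valued process such that the forward SDE $\mathrm{d}X_s=K_s\,\mathrm{d}s+\sigma(s,X_s)\,\mathrm{d}W^{\mathsf P}_s$, $X_0=x_0$, $s\in[0,T]$, admits a unique square-integrable solution (a unique strong, adapted, continuous solution with, for every $p\ge1$, a constant $C$ such that $\mathbf{E}_{\mathsf P}[\sup_{s\in[0,T]}|X_s|^p]\le C(1+|x_0|^p)$ and $\mathbf{E}_{\mathsf P}[|X_s-X_r|^p]\le C(1+|x_0|^p)|s-r|^{p/2}$ for $s,r\in[0,T]$), and $\mathbf{E}_{\mathsf P}[\exp(\tfrac12\int_0^T\|\sigma(s,X_s)^{-1}K_s\|^2\,\mathrm{d}s)]<\infty$. With $\sigma_s:=\sigma(s,X_s)$, $f^\mu_s:=f^\mu(s,X_s)$, $\ell^\mu_s:=\ell^\mu(s,X_s)$, $D_s:=\sigma_s^{-1}(f^\mu_s-K_s)$, the pair $(Y_s,Z_s)$ is the $\mathcal{F}_s$-adapted solution of $$\mathrm{d}Y_s=-(\ell^\mu_s+Z_s^\top D_s)\,\mathrm{d}s+Z_s^\top\,\mathrm{d}W^{\mathsf P}_s,\qquad Y_T=g(X_T),$$ which satisfies $\mathsf P$-a.s. $Y_s=V^\mu(s,X_s)$ for $s\in[0,T]$ and $Z_s=\sigma_s^\top\partial_xV^\mu(s,X_s)$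 for a.e. $s\in[0,T]$. Weighted measure. $\mathsf P_\tau$ denotes the measure $\mathsf P$ considered on $\mathcal{F}_\tau$. $\rho_\tau$ is a bounded ($\mathcal{F}_\tau$-measurable, real-valued) random variable, $\lambda>0$ is a constant, and the induced probability measure $\mathsf R_\tau$ on $\mathcal{F}_\tau$ is $$\mathrm{d}\mathsf R_\tau=\Theta^{\mathsf R|\mathsf P}_\tau\,\mathrm{d}\mathsf P_\tau,\qquad \Theta^{\mathsf R|\mathsf P}_\tau:=\frac{\exp(-\rho_\tau/\lambda)}{\mathbf{E}_{\mathsf P_\tau}[\exp(-\rho_\tau/\lambda)]},$$ which is the minimizer over $\mathsf R_\tau$ of $\mathbf{E}_{\mathsf R_\tau}[\rho_\tau]+\lambda\,\mathbf{E}_{\mathsf R_\tau}[\log(\mathrm{d}\mathsf R_\tau/\mathrm{d}\mathsf P_\tau)]$. *)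

(* Defs.v *)
From HB Require Import structures.
From mathcomp Require Import all_boot all_order all_algebra.
From mathcomp Require Import all_classical all_reals all_analysis.

Set Implicit Arguments.
Unset Strict Implicit.
Unset Printing Implicit Defensive.

Import Order.TTheory GRing.Theory Num.Theory.
Import numFieldNormedType.Exports.

Local Open Scope classical_set_scope.
Local Open Scope ring_scope.

(* Norms.  [`|_|] on vectors, matrices and products is the library's max norm;
   it is used wherever only the equivalence class of the norm matters (uniform
   continuity, Lipschitz and growth conditions, moment bounds).  [sqnorm] is
   the squared Euclidean norm. *)
Section Vectors.
Context {R : realType} {n : nat}.

Definition dotv (u v : 'cV[R]_n) : R := \sum_(i < n) u i 0 * v i 0.

Definition sqnorm (u : 'cV[R]_n) : R := dotv u u.

Definition grad (v : 'cV[R]_n -> R) (x : 'cV[R]_n) : 'cV[R]_n :=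
  \col_i 'D_(delta_mx i 0) v x.

Definition hessian (v : 'cV[R]_n -> R) (x : 'cV[R]_n) : 'M[R]_n :=
  \matrix_(i, j)
    'D_(delta_mx i 0) (fun y => 'D_(delta_mx j 0) v y) x.

End Vectors.

Definition unif_cont_on {R : realType} {E E' : normedZmodType R} (D : set E)
    (f : E -> E') : Prop :=
  forall e : R, 0 < e -> exists2 delta : R, 0 < delta &
    forall p q, D p -> D q -> `|p - q| < delta -> `|f p - f q| < e.

(* One-sided at the endpoints when [D] is a compact interval. *)
Definition is_deriv_on {R : realType} (D : set R) (f : R -> R) (a l : R) : Prop :=
  h^-1 * (f (a + h) - f a) @[h --> within [set h | D (a + h)] (dnbhs (0 : R))]
    --> l.

Record control_problem (R : realType) (n m : nat) := ControlProblem {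
  horizon : R;
  controls : set 'cV[R]_m;
  drift : R -> 'cV[R]_n -> 'cV[R]_m -> 'cV[R]_n;
  diffusion : R -> 'cV[R]_n -> 'M[R]_n;
  running_cost : R -> 'cV[R]_n -> 'cV[R]_m -> R;
  terminal_cost : 'cV[R]_n -> R;
  policy : R -> 'cV[R]_n -> 'cV[R]_n -> 'cV[R]_m
}.

Section ControlProblem.
Context {R : realType} {n m : nat} (pb : control_problem R n m).
Let T := horizon pb.
Let U := controls pb.
Let f := drift pb.
Let sigma := diffusion pb.
Let ell := running_cost pb.
Let g := terminal_cost pb.
Let mu := policy pb.
Let I : set R := `[0, T].

(* The data are functions on [0,T] x R^n x U, encoded by total functions whose
   values outside of that set are never used. *)
Definition well_formed : Prop :=
  [/\ 0 < T, compact U,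
      (forall t x z, I t -> U (mu t x z)),
      (forall t x u, I t -> U u -> 0 <= ell t x u)
    & (forall x, 0 <= g x)].

Definition hmu (t : R) (x z : 'cV[R]_n) : R :=
  ell t x (mu t x z) + dotv z (invmx (sigma t x) *m f t x (mu t x z)).

Definition data_regularity : Prop :=
  [/\ [/\ unif_cont_on [set p : R * 'cV[R]_n * 'cV[R]_m | I p.1.1 /\ U p.2]
            (fun p => f p.1.1 p.1.2 p.2),
          unif_cont_on [set p : R * 'cV[R]_n | I p.1]
            (fun p => sigma p.1 p.2),
          unif_cont_on [set p : R * 'cV[R]_n * 'cV[R]_m | I p.1.1 /\ U p.2]
            (fun p => ell p.1.1 p.1.2 p.2)
        & unif_cont_on [set: 'cV[R]_n] g],
      (exists L : R, forall t u x y, I t -> U u ->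
        [/\ `|f t x u - f t y u| <= L * `|x - y|,
            `|sigma t x - sigma t y| <= L * `|x - y|,
            `|ell t x u - ell t y u| <= L * `|x - y|
          & `|g x - g y| <= L * `|x - y|]),
      (exists C : R, forall t x, I t -> `|sigma t x| <= C * (1 + `|x|)),
      (exists (C : R) (k : nat), forall x, `|g x| <= C * (1 + `|x| ^+ k))
    & (forall t x, I t -> sigma t x \in unitmx) /\
      (exists C : R, forall t x, I t -> `|invmx (sigma t x)| <= C)].

Definition hmu_regularity : Prop :=
  [/\ (forall z, unif_cont_on [set p : R * 'cV[R]_n | I p.1]
         (fun p => hmu p.1 p.2 z)),
      (exists L : R, forall t x z z', I t ->
         `|hmu t x z - hmu t x z'| <= L * `|z - z'|)
    & (forall z, exists (C : R) (k : nat), forall t x, I t ->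
         `|hmu t x z| <= C * (1 + `|x| ^+ k))].

Definition classical_solution (V : R -> 'cV[R]_n -> R) : Prop :=
  let D := [set p : R * 'cV[R]_n | I p.1] in
  exists Vt : R -> 'cV[R]_n -> R,
  [/\ (forall t x, I t -> is_deriv_on I (V ^~ x) t (Vt t x)),
      (forall t x i j, I t ->
         derivable (V t) x (delta_mx i 0) /\
         derivable (fun y => 'D_(delta_mx j 0) (V t) y) x (delta_mx i 0)),
      [/\ {within D, continuous (fun p => V p.1 p.2)},
          {within D, continuous (fun p => Vt p.1 p.2)},
          {within D, continuous (fun p => grad (V p.1) p.2)}
        & {within D, continuous (fun p => hessian (V p.1) p.2)}],
      (forall t x, I t ->
         Vt t x
         + 2^-1 * \tr (sigma t x *m (sigma t x)^T *m hessian (V t) x)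
         + hmu t x ((sigma t x)^T *m grad (V t) x) = 0)
    & (forall x, V T x = g x)].

Definition feedback (V : R -> 'cV[R]_n -> R) (t : R) (x : 'cV[R]_n) : 'cV[R]_m :=
  mu t x ((sigma t x)^T *m grad (V t) x).

Definition fmu (V : R -> 'cV[R]_n -> R) (t : R) (x : 'cV[R]_n) : 'cV[R]_n :=
  f t x (feedback V t x).

Definition ellmu (V : R -> 'cV[R]_n -> R) (t : R) (x : 'cV[R]_n) : R :=
  ell t x (feedback V t x).

End ControlProblem.

Definition borel (E : topologicalType) : set_system E := <<s @open E >>.

Definition measurable_wrt {Omega : Type} {E : topologicalType}
    (G : set_system Omega) (X : Omega -> E) : Prop :=
  forall B, borel B -> G (X @^-1` B).

Definition sigma_gen {Omega : Type} {E : topologicalType} (X : Omega -> E) :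
    set_system Omega :=
  preimage_set_system setT X (@borel E).

Section Processes.
Context {R : realType} {d : measure_display} {Omega : measurableType d}.

Definition complete_filtration (P : probability Omega R) (T : R)
    (F : R -> set_system Omega) : Prop :=
  [/\ measure_is_complete P,
      (forall s, 0 <= s <= T -> sigma_algebra setT (F s)),
      (forall s A, 0 <= s <= T -> F s A -> measurable A),
      (forall r s, 0 <= r -> r <= s -> s <= T -> F r `<=` F s)
    & (forall A, P.-negligible A -> F 0 A)].

Definition adapted {E : topologicalType} (F : R -> set_system Omega) (T : R)
    (X : R -> Omega -> E) : Prop :=
  forall s, 0 <= s <= T -> measurable_wrt (F s) (X s).

Definition continuous_paths {E : topologicalType} (P : probability Omega R)
    (a b : R) (X : R -> Omega -> E) : Prop :=
  {ae P, forall w, {within `[a, b], continuous (X ^~ w)}}.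

(* For every [s], the map [(r, w) |-> X r w] on [0,s] x Omega is measurable
   for the product of the Borel sigma-algebra of [0,s] and [F s]. *)
Definition progressive {E : topologicalType} (F : R -> set_system Omega) (T : R)
    (X : R -> Omega -> E) : Prop :=
  forall s, 0 <= s <= T -> forall B, @borel E B ->
    let D : set (R * Omega) := `[0, s]%classic `*` setT in
    <<s D, [set C | exists A A' : set _,
              [/\ borel A, A `<=` `[0, s], F s A' & C = A `*` A']] >>
      (D `&` [set p | B (X p.1 p.2)]).

(* [W], up to its initial value, is a Brownian motion relative to [F] on
   [a,b]. *)
Definition brownian_on {n : nat} (Q : probability Omega R)
    (F : R -> set_system Omega) (a b : R) (W : R -> Omega -> 'cV[R]_n) : Prop :=
  [/\ (forall s, a <= s <= b -> measurable_wrt (F s) (W s)),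
      continuous_paths Q a b W,
      (forall r s, a <= r -> r < s -> s <= b ->
         forall A B, F r A -> borel B ->
         (Q (A `&` [set w | B (W s w - W r w)%R]) =
            Q A * Q [set w | B (W s w - W r w)%R])%E)
    & (forall r s, a <= r -> r < s -> s <= b ->
         forall B : 'I_n -> set R, (forall i, measurable (B i)) ->
         Q [set w | forall i, B i ((W s w - W r w) i 0)] =
           (\prod_(i < n) normal_prob 0 (Num.sqrt (s - r)) (B i))%E)].

Definition standard_brownian {n : nat} (P : probability Omega R)
    (F : R -> set_system Omega) (T : R) (W : R -> Omega -> 'cV[R]_n) : Prop :=
  brownian_on P F 0 T W /\ {ae P, forall w, W 0 w = 0}.

(* The simple integrand \sum_k sp_coef k * 1_{]sp_time k, sp_time k.+1]}. *)
Record simple_process (n : nat) (F : R -> set_system Omega) (T : R) :=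
  SimpleProcess {
  sp_size : nat;
  sp_time : nat -> R;
  sp_coef : nat -> Omega -> 'cV[R]_n;
  sp_time_range : forall k, (k <= sp_size)%N -> 0 <= sp_time k <= T;
  sp_time_mono : forall k, (k < sp_size)%N -> sp_time k <= sp_time k.+1;
  sp_coef_meas : forall k, (k < sp_size)%N ->
    measurable_wrt (F (sp_time k)) (sp_coef k);
  sp_coef_bnd : exists C : R, forall k w, (k < sp_size)%N ->
    `|sp_coef k w| <= C
}.

Definition sp_fun {n F T} (H : @simple_process n F T) (s : R) (w : Omega) :
    'cV[R]_n :=
  \sum_(k < sp_size H)
    if sp_time H k < s <= sp_time H k.+1 then sp_coef H k w else 0.

Definition sp_integral {n F T} (W : R -> Omega -> 'cV[R]_n)
    (H : @simple_process n F T) (s : R) (w : Omega) : R :=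
  \sum_(k < sp_size H)
    dotv (sp_coef H k w)
      (W (Num.min s (sp_time H k.+1)) w - W (Num.min s (sp_time H k)) w).

Definition l2_norm_sq {n} (P : probability Omega R) (T : R)
    (Z : R -> Omega -> 'cV[R]_n) : \bar R :=
  (\int[P]_w \int[lebesgue_measure]_(s in `[0%R, T]) (sqnorm (Z s w))%:E)%E.

(* [M] is (a continuous version of) the Ito integral \int_0^. Z_s^T dW_s of
   the square-integrable integrand [Z], as an L^2 limit of integrals of simple
   processes. *)
Definition ito_integral {n} (P : probability Omega R)
    (F : R -> set_system Omega) (T : R) (W : R -> Omega -> 'cV[R]_n)
    (Z : R -> Omega -> 'cV[R]_n) (M : R -> Omega -> R) : Prop :=
  [/\ progressive F T Z, (l2_norm_sq P T Z < +oo)%E,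
      adapted F T M, continuous_paths P 0 T M
    & exists H : nat -> @simple_process n F T,
      l2_norm_sq P T (fun s w => sp_fun (H k) s w - Z s w) @[k --> \oo]
        --> 0%E /\
      forall s, 0 <= s <= T ->
        ('E_P[(fun w => (sp_integral W (H k) s w - M s w) ^+ 2)%R])%E
          @[k --> \oo] --> 0%E].

Definition moment_bounds {n} (P : probability Omega R) (T : R)
    (x0 : 'cV[R]_n) (X : R -> Omega -> 'cV[R]_n) : Prop :=
  forall p : R, 1 <= p -> exists C : R,
    ((\int[P]_w ereal_sup [set (`|X s w| `^ p)%:E | s in `[0%R, T]%classic]
       <= (C * (1 + `|x0| `^ p))%:E)%E) /\
    (forall s r, 0 <= s <= T -> 0 <= r <= T ->
       ('E_P[(fun w => `|X s w - X r w| `^ p)%R] <=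
         (C * (1 + `|x0| `^ p) * `|s - r| `^ (p / 2))%:E)%E).

(* A version [C] of the conditional expectation E_Q[Y | X]. *)
Definition cond_expectation {E : topologicalType} (Q : probability Omega R)
    (X : Omega -> E) (Y C : Omega -> R) : Prop :=
  [/\ Q.-integrable setT (EFin \o Y), Q.-integrable setT (EFin \o C),
      measurable_wrt (sigma_gen X) C
    & forall A, sigma_gen X A ->
        (\int[Q]_(w in A) (C w)%:E = \int[Q]_(w in A) (Y w)%:E)%E].

(* The functions [phi] for which [phi(X)] is an [X]-measurable random variable
   in L^2(Q). *)
Definition l2_regressors {E : topologicalType} (Q : probability Omega R)
    (X : Omega -> E) : set (E -> R) :=
  [set phi | measurable_wrt (@borel E) phi /\ (phi \o X) \in Lfun Q 2%:E].

Definition gibbs_weight (Q : probability Omega R) (rho : Omega -> R)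
    (lambda : R) (w : Omega) : R :=
  expR (- rho w / lambda)
  / fine ('E_Q[(fun w' => expR (- rho w' / lambda))%R])%E.

End Processes.

Definition is_minimizer {R : realType} {A : Type} (S : set A) (J : A -> \bar R)
    (a : A) : Prop :=
  S a /\ forall b, S b -> (J a <= J b)%E.

Section DriftedFBSDE.
Context {R : realType} {d : measure_display} {Omega : measurableType d}.
Context {n m : nat} (pb : control_problem R n m).
Context (P : probability Omega R) (F : R -> set_system Omega).
Context (W : R -> Omega -> 'cV[R]_n).
Let T := horizon pb.
Let sigma := diffusion pb.

Definition forward_solution (x0 : 'cV[R]_n) (K X : R -> Omega -> 'cV[R]_n) :
    Prop :=
  [/\ adapted F T X, continuous_paths P 0 T X, moment_bounds P T x0 X,
      {ae P, forall w, forall i,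
         lebesgue_measure.-integrable `[0, T] (fun s => (K s w i 0)%:E)}
    & exists M : 'I_n -> R -> Omega -> R,
      (forall i, ito_integral P F T W
         (fun s w => (row i (sigma s (X s w)))^T) (M i)) /\
      {ae P, forall w, forall s, 0 <= s <= T -> forall i,
         X s w i 0 = x0 i 0 + \int[lebesgue_measure]_(r in `[0, s]) K r w i 0
                     + M i s w}].

Definition unique_forward_solution (x0 : 'cV[R]_n)
    (K X : R -> Omega -> 'cV[R]_n) : Prop :=
  forward_solution x0 K X /\
  forall X', forward_solution x0 K X' ->
    {ae P, forall w, forall s, 0 <= s <= T -> X' s w = X s w}.

Definition novikov (K X : R -> Omega -> 'cV[R]_n) : Prop :=
  (\int[P]_w expeR (2^-1%:E *
     \int[lebesgue_measure]_(s in `[0%R, T])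
       (sqnorm (invmx (sigma s (X s w)) *m K s w))%:E) < +oo)%E.

Definition Dproc (V : R -> 'cV[R]_n -> R) (K X : R -> Omega -> 'cV[R]_n)
    (s : R) (w : Omega) : 'cV[R]_n :=
  invmx (sigma s (X s w)) *m (fmu pb V s (X s w) - K s w).

Definition driver (V : R -> 'cV[R]_n -> R) (K X Z : R -> Omega -> 'cV[R]_n)
    (s : R) (w : Omega) : R :=
  ellmu pb V s (X s w) + dotv (Z s w) (Dproc V K X s w).

(* An adapted solution of a backward SDE is, as usual, a pair in
   L^2_F(Omega; C[0,T]) x L^2_F(0,T); the square integrability of [Z] is part
   of [ito_integral]. *)
Definition backward_solution (V : R -> 'cV[R]_n -> R)
    (K X : R -> Omega -> 'cV[R]_n) (Y : R -> Omega -> R)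
    (Z : R -> Omega -> 'cV[R]_n) : Prop :=
  [/\ adapted F T Y, continuous_paths P 0 T Y,
      (\int[P]_w ereal_sup [set (Y s w ^+ 2)%:E | s in `[0%R, T]%classic]
        < +oo)%E,
      {ae P, forall w, lebesgue_measure.-integrable `[0, T]
         (fun s => (driver V K X Z s w)%:E)}
    & exists M : R -> Omega -> R, ito_integral P F T W Z M /\
      {ae P, forall w, forall s, 0 <= s <= T ->
         Y s w = terminal_cost pb (X T w)
                 + \int[lebesgue_measure]_(r in `[s, T]) driver V K X Z r w
                 - (M T w - M s w)}].

Definition feynman_kac (V : R -> 'cV[R]_n -> R) (X : R -> Omega -> 'cV[R]_n)
    (Y : R -> Omega -> R) (Z : R -> Omega -> 'cV[R]_n) : Prop :=
  {ae P, forall w, forall s, 0 <= s <= T -> Y s w = V s (X s w)} /\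
  {ae P, forall w, {ae lebesgue_measure, forall s, 0 <= s <= T ->
     Z s w = (sigma s (X s w))^T *m grad (V s) (X s w)}}.

Definition Yhat (V : R -> 'cV[R]_n -> R) (K X : R -> Omega -> 'cV[R]_n)
    (Y : R -> Omega -> R) (Z : R -> Omega -> 'cV[R]_n) (t tau : R)
    (w : Omega) : R :=
  Y tau w + \int[lebesgue_measure]_(s in `[t, tau]) driver V K X Z s w.

End DriftedFBSDE.

(* Main.v *)
Require Import Defs.
From mathcomp Require Import finmap.
From HB Require Import structures.
From mathcomp Require Import all_boot all_order all_algebra.
From mathcomp Require Import all_classical all_reals all_analysis.
From mathcomp Require Import measurable_realfun.
From mathcomp Require Import ring lra.
Set Implicit Arguments.
Unset Strict Implicit.
Import Order.TTheory GRing.Theory Num.Theory.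
Import numFieldNormedType.Exports.
Local Open Scope classical_set_scope.
Local Open Scope ring_scope.

(** The backward equation, read at the times t and tau and subtracted, says
    that the target of the regression is the value at time t plus noise:
    Yhat = Y_t + N with N = M_tau - M_t the increment of the stochastic integral
    of Z (Yhat_increment), and Y_t = V(t, X_t).  Everything follows once N is
    known to be square integrable under R_tau and orthogonal in L^2(R_tau) to
    every F_t-measurable square integrable variable: then V(t, X_t) is the
    conditional expectation of Yhat given X_t, and by Pythagoras

      E_R[(Yhat - phi(X_t))^2] = E_R[N^2] + E_R[(V(t, X_t) - phi(X_t))^2],

    so V(t, .) is the minimizer and the only one up to null sets
    (section Regression).

    The orthogonality cannot be read off from N being a P-martingale increment,
    because the measure has been changed; it comes from W being Brownian under
    R_tau.  A Brownian increment over [r, s] is centered and independent of F_r,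
    so its product with any F_r-measurable factor integrates to zero
    (brownian_increment_orthogonal).  Hence the integral of a simple process
    over [t, tau] is orthogonal to F_t under R_tau
    (stochastic_sum_orthogonal).  The stochastic integral is an L^2(P)-limit of
    such sums, and since rho is bounded the Gibbs density lies between two
    positive constants, so it is also their L^2(R_tau)-limit, and orthogonality
    survives the limit (ito_increment_orthogonal).

    The same two-sided bound makes L^2(P_tau) and L^2(R_tau) the same space, and
    the two losses are equal by change of density; hence the two optimization
    problems are one.  Completeness of the filtration enters to transfer
    almost sure statements from P to R_tau and to make Yhat, which is only
    almost surely equal to an F_tau-measurable variable, F_tau-measurable. *)

(** * Measurability with respect to a sub-sigma-algebra *)

Section SubSigmaAlgebra.
Context {R : realType} {d : measure_display} {T : measurableType d}.
Implicit Types (G : set_system T) (f : T -> R).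

Lemma borel_realE : @borel R = @measurable _ (measurableTypeR R).
Proof.
rewrite RGenOpens.measurableE eqEsubset; split=> A.
  apply: smallest_sub; first exact: smallest_sigma_algebra.
  by move=> B oB; rewrite -RGenOpens.measurableE; exact: open_measurable.
apply: smallest_sub; first exact: smallest_sigma_algebra.
by move=> B [x [y ->]]; apply: sub_sigma_algebra; exact: interval_open.
Qed.

Lemma measurable_wrtP G f : sigma_algebra setT G ->
  measurable_wrt G f <->
  measurable_fun setT (f : g_sigma_algebraType G -> measurableTypeR R).
Proof.
move=> sG; split=> [mf _ B mB | mf B].
  by rewrite setTI; apply: sub_sigma_algebra; apply: mf; rewrite borel_realE.
rewrite borel_realE => mB; have := mf measurableT B mB; rewrite setTI.
by rewrite -[X in _ -> X _](sigma_algebra_id sG).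
Qed.

Lemma measurable_wrt_fun G f : G `<=` measurable ->
  measurable_wrt G f -> measurable_fun setT (f : T -> measurableTypeR R).
Proof.
move=> GT mf _ B mB; rewrite setTI; apply: GT; apply: mf.
by rewrite borel_realE.
Qed.

End SubSigmaAlgebra.

(** * Integrals against a variable centered on a sub-sigma-algebra *)

Section Centered.
Context {R : realType} {d : measure_display} {T : measurableType d}.
Variables (Q : probability T R) (G : set_system T) (N : T -> R).
Hypotheses (sG : sigma_algebra setT G) (GT : G `<=` measurable).
Hypothesis iN : Q.-integrable setT (EFin \o N).
Hypothesis N0 : forall A, G A -> (\int[Q]_(x in A) (N x)%:E = 0)%E.

Import HBNNSimple.

Let integral_mul_nnsfun (h : {nnsfun (g_sigma_algebraType G) >-> R}) :
  (\int[Q]_x (h x * N x)%:E = 0)%E.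
Proof.
have mh y : G (h @^-1` [set y]).
  have : measurable (h @^-1` [set y]) by exact: measurable_sfunP.
  by rewrite -[X in _ -> X _](sigma_algebra_id sG).
have indE y : (fun x => (\1_(h @^-1` [set y]) x * N x)%:E) =
    (EFin \o N) \_ (h @^-1` [set y]).
  apply/funext => x; rewrite indicE patchE; case: ifPn => xh.
    by rewrite mul1r.
  by rewrite mul0r.
transitivity (\int[Q]_x
   \sum_(y <- fset_set (range h))
     (y%:E * (\1_(h @^-1` [set y]) x * N x)%:E))%E.
  apply: eq_integral => x _; rewrite (fimfunE h) fsbig_finite//= mulr_suml.
  by rewrite -sumEFin; apply: eq_bigr => y _; rewrite -EFinM mulrA.
have ind y : Q.-integrable setT (fun x => (\1_(h @^-1` [set y]) x * N x)%:E).
  rewrite indE -integrable_mkcond//; last exact: GT.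
  by apply: integrableS iN => //; exact: GT.
rewrite integral_sum//; last by move=> y; exact: integrableZl.
apply: big1 => y _; rewrite integralZl// indE -integral_mkcond.
by rewrite N0// mule0.
Qed.

Let integral_mul_ge0 (xi : T -> R) : measurable_wrt G xi ->
  (forall x, 0 <= xi x) ->
  Q.-integrable setT (fun x => (xi x * N x)%:E) ->
  (\int[Q]_x (xi x * N x)%:E = 0)%E.
Proof.
move=> mxi xi0 ixiN; have mxi' := (measurable_wrtP xi sG).1 mxi.
have mxiE : measurable_fun setT
    ((EFin \o xi) : g_sigma_algebraType G -> \bar R).
  exact/measurable_EFinP.
pose h := nnsfun_approx measurableT mxiE.
have mh n : measurable_fun setT ((h n : T -> R) : T -> measurableTypeR R).
  move=> _ B mB; rewrite setTI; apply: GT.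
  have : measurable (h n @^-1` B) by exact: measurable_sfunP.
  by rewrite -[X in _ -> X _](sigma_algebra_id sG).
have mN : measurable_fun setT N by apply/measurable_EFinP; exact: measurable_int iN.
have [|||||_ _ +] := @dominated_convergence _ T R Q setT measurableT
    (fun n x => (h n x * N x)%:E) (fun x => (xi x * N x)%:E)
    (fun x => `|(xi x * N x)%:E|%E).
- move=> n; apply/measurable_EFinP; apply: measurable_funM; last exact: mN.
  exact: mh.
- exact: measurable_int ixiN.
- apply/aeW => x _; under eq_fun do rewrite EFinM; rewrite EFinM.
  apply: cvgeZr => //.
  have xiE0 y : setT y -> (0 <= (EFin \o xi) y)%E by rewrite lee_fin.
  exact: (cvg_nnsfun_approx measurableT mxiE xiE0).
- exact: integrable_abse.
(* The approximations increase to [xi], so [xi * N] itself dominates. *)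
- apply/aeW => x n _; rewrite /= lee_fin !normrM ler_wpM2r//.
  rewrite !ger0_norm// -lee_fin /h nnsfun_approxE.
  by apply: le_approx => // y _; rewrite lee_fin.
move=> cv; apply/esym.
have : (fun n => \int[Q]_x (h n x * N x)%:E)%E = cst 0%E.
  by apply/funext => n; exact: integral_mul_nnsfun.
by move=> E; move: cv; rewrite E => /cvg_lim <- //; rewrite lim_cst.
Qed.

(** The hypothesis on [N] is the case of indicators; simple functions follow by
    linearity, nonnegative [xi] by dominated convergence, and the general case
    by splitting [xi] into its positive and negative parts.  Independence of
    increments and uniqueness of conditional expectations both reduce to this. *)
Lemma integral_mul_centered (xi : T -> R) : measurable_wrt G xi ->
  Q.-integrable setT (fun x => (xi x * N x)%:E) ->
  (\int[Q]_x (xi x * N x)%:E = 0)%E.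
Proof.
move=> mxi ixiN; have mxi' := (measurable_wrtP xi sG).1 mxi.
have mN : measurable_fun setT N by apply/measurable_EFinP; exact: measurable_int iN.
have part (p : T -> R) : measurable_wrt G p -> (forall x, 0 <= p x) ->
    (forall x, p x <= `|xi x|) ->
    Q.-integrable setT (fun x => (p x * N x)%:E) /\
    (\int[Q]_x (p x * N x)%:E = 0)%E.
  move=> mp p0 pxi.
  have ip : Q.-integrable setT (fun x => (p x * N x)%:E).
    apply: le_integrable ixiN => //.
      apply/measurable_EFinP; apply: measurable_funM => //.
      exact: measurable_wrt_fun mp.
    by move=> x _; rewrite /= lee_fin !normrM ler_wpM2r// ger0_norm.
  by split => //; exact: integral_mul_ge0.
have [|||ip p0] := part (fun x => Num.max (xi x) 0).
- exact/measurable_wrtP/measurable_maxr.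
- by move=> x; rewrite le_max lexx orbT.
- by move=> x; rewrite ge_max ler_norm normr_ge0.
have [|||iq q0] := part (fun x => Num.max (- xi x) 0).
- apply/measurable_wrtP => //; apply: measurable_maxr => //.
  exact: measurableT_comp.
- by move=> x; rewrite le_max lexx orbT.
- by move=> x; rewrite ge_max -normrN ler_norm normr_ge0.
transitivity (\int[Q]_x ((Num.max (xi x) 0 * N x)%:E
    - (Num.max (- xi x) 0 * N x)%:E))%E.
  apply: eq_integral => x _; rewrite -EFinB; congr EFin; rewrite -mulrBl.
  congr (_ * _); have [x0|/ltW x0] := lerP 0 (xi x).
    by rewrite (max_idPr _) ?oppr_le0// subr0.
  by rewrite (max_idPl _) ?oppr_ge0// sub0r opprK.
by rewrite integralB// p0 q0 sube0.
Qed.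

End Centered.

(** * Changing the density of a measure *)

Section Density.
Context {R : realType} {d : measure_display} {T : measurableType d}.
Local Open Scope ereal_scope.

(** A density that represents [nu] on every measurable set agrees almost
    everywhere with the Radon-Nikodym derivative, for which the change of
    variables is known. *)
Lemma ge0_integral_density (mu : {sigma_finite_measure set T -> \bar R})
    (nu : {finite_measure set T -> \bar R}) (h : T -> R) (f : T -> \bar R) :
  mu.-integrable setT (EFin \o h) ->
  (forall A, measurable A -> nu A = \int[mu]_(x in A) (h x)%:E) ->
  measurable_fun setT f -> (forall x, 0 <= f x) ->
  \int[nu]_x f x = \int[mu]_x (f x * (h x)%:E).
Proof.
move=> ih nuE mf f0; have numu : nu `<< mu.
  apply/null_content_dominatesP => A mA muA0; rewrite nuE//.
  apply: null_set_integral => //; apply: measurable_funTS.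
  exact: measurable_int ih.
have iRN := Radon_Nikodym_SigmaFinite.f_integrable numu.
rewrite -(Radon_Nikodym_SigmaFinite.change_of_variables numu)//.
have mh := measurable_int _ ih.
apply: ae_eq_integral => //.
- by apply: emeasurable_funM => //; exact: measurable_int iRN.
- exact: emeasurable_funM.
have : ae_eq mu setT (Radon_Nikodym_SigmaFinite.f nu mu) (EFin \o h).
  apply: integral_ae_eq => // E _ mE.
  by rewrite -Radon_Nikodym_SigmaFinite.f_integral// nuE.
by apply: filterS => x /= /(_ I) -> _.
Qed.

End Density.

(** * Square integrable random variables *)

Section SquareIntegrable.
Context {R : realType} {d : measure_display} {T : measurableType d}.
Variable Q : probability T R.
Implicit Types f g : T -> R.

Definition sq_integrable f : Prop :=
  measurable_fun setT f /\ (\int[Q]_x (f x ^+ 2)%:E < +oo)%E.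

Lemma sq_integrable_Lfun f : f \in Lfun Q 2%:E <-> sq_integrable f.
Proof.
split=> [fL|[mf f2]].
  split; first by move: fL; rewrite inE => /andP[/[!inE]].
  exact: integrable_lty (Lfun2_integrable_sqr fL).
rewrite inE; apply/andP; split; rewrite inE/= /finite_norm//.
rewrite unlock; apply: poweR_lty.
rewrite (_ : \int[Q]_x _ = \int[Q]_x (f x ^+ 2)%:E)%E//.
by apply: eq_integral => x _; rewrite /= powR_mulrn// real_normK// num_real.
Qed.

Lemma sq_integrable_le f g : measurable_fun setT f -> sq_integrable g ->
  (forall x, f x ^+ 2 <= g x ^+ 2) -> sq_integrable f.
Proof.
move=> mf [mg g2] fg; split => //; apply: le_lt_trans g2.
apply: ge0_le_integral => //.
- by move=> x _; rewrite lee_fin sqr_ge0.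
- by apply/measurable_EFinP; exact: measurable_funX.
- by apply/measurable_EFinP; exact: measurable_funX.
- by move=> x _; rewrite lee_fin.
Qed.

Lemma sq_integrableP f : sq_integrable f ->
  Q.-integrable setT (fun x => (f x ^+ 2)%:E).
Proof.
move=> [mf f2]; apply/integrableP; split.
  by apply/measurable_EFinP; exact: measurable_funX.
by under eq_integral do rewrite gee0_abs ?lee_fin ?sqr_ge0//.
Qed.

Lemma sq_integrableZ (c : R) f : sq_integrable f ->
  sq_integrable (fun x => c * f x).
Proof.
move=> fL; split; first by case: fL => ? _; exact: measurable_funM.
apply: integrable_lty => //.
rewrite (_ : (fun _ => _) = (fun x => (c ^+ 2)%:E * (f x ^+ 2)%:E)%E).
  exact/integrableZl/sq_integrableP.
by apply/funext => x; rewrite -EFinM exprMn.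
Qed.

Lemma sq_integrableD f g : sq_integrable f -> sq_integrable g ->
  sq_integrable (fun x => f x + g x).
Proof.
move=> fL gL; have mfg : measurable_fun setT (fun x => f x + g x).
  by case: fL gL => ? _ [? _]; exact: measurable_funD.
split => //; have : Q.-integrable setT
    (fun x => 2%:E * (f x ^+ 2)%:E + 2%:E * (g x ^+ 2)%:E)%E.
  by apply: integrableD => //; apply: integrableZl => //; exact: sq_integrableP.
move=> /(integrable_lty measurableT); apply: le_lt_trans.
apply: ge0_le_integral => //.
- by move=> x _; rewrite lee_fin sqr_ge0.
- by apply/measurable_EFinP; exact: measurable_funX.
- by case: fL gL => ? _ [? _]; apply: emeasurable_funD;
    apply: measurable_funeM; apply/measurable_EFinP; exact: measurable_funX.
move=> x _; rewrite -!EFinM -EFinD lee_fin.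
have := sqr_ge0 (f x - g x); rewrite sqrrB sqrrD; lra.
Qed.

Lemma sq_integrableB f g : sq_integrable f -> sq_integrable g ->
  sq_integrable (fun x => f x - g x).
Proof.
move=> fL gL; have := sq_integrableD fL (sq_integrableZ (-1) gL).
by under eq_fun do rewrite mulN1r.
Qed.

Lemma sq_integrable_sum (I : Type) (s : seq I) (F : I -> T -> R) :
  (forall i, sq_integrable (F i)) -> sq_integrable (fun x => \sum_(i <- s) F i x).
Proof.
move=> FL; elim: s => [|i s IH].
  under eq_fun do rewrite big_nil.
  split => //=; under eq_integral do rewrite expr0n/=.
  by rewrite integral0.
by under eq_fun do rewrite big_cons; exact: sq_integrableD.
Qed.

Lemma sq_integrableM f g : sq_integrable f -> sq_integrable g ->
  Q.-integrable setT (fun x => (f x * g x)%:E).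
Proof.
move=> fL gL.
have : Q.-integrable setT (fun x => (f x ^+ 2)%:E + (g x ^+ 2)%:E)%E.
  by apply: integrableD => //; exact: sq_integrableP.
apply: le_integrable => //.
  by apply/measurable_EFinP; case: fL gL => ? _ [? _]; exact: measurable_funM.
move=> x _; rewrite -EFinD /= lee_fin [leRHS]ger0_norm; last first.
  by rewrite addr_ge0 ?sqr_ge0.
rewrite normrM -(real_normK (num_real (f x))) -(real_normK (num_real (g x))).
have := sqr_ge0 (`|f x| - `|g x|); rewrite sqrrB.
have := normr_ge0 (f x); have := normr_ge0 (g x); nra.
Qed.

Lemma sq_integrable_cst (c : R) : sq_integrable (fun=> c).
Proof.
split => //; rewrite integral_cst//= probability_setT mule1.
by rewrite ltry.
Qed.

Lemma sq_integrable_indic (A : set T) : measurable A ->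
  sq_integrable (\1_A : T -> R).
Proof.
move=> mA; apply: (sq_integrable_le _ (sq_integrable_cst 1)).
  exact: measurable_indic.
by move=> x; rewrite indicE; case: (x \in A); rewrite ?expr1n ?expr0n.
Qed.

Lemma sq_integrable_integrable f : sq_integrable f ->
  Q.-integrable setT (EFin \o f).
Proof.
move=> fL; have := sq_integrableM fL (sq_integrable_cst 1).
by under eq_fun do rewrite mulr1.
Qed.

Lemma sq_integrable_bdM (C : R) f g : measurable_fun setT f ->
  (forall x, `|f x| <= C) -> sq_integrable g ->
  sq_integrable (fun x => f x * g x).
Proof.
move=> mf fC gL; apply: (sq_integrable_le _ (sq_integrableZ C gL)).
  by case: gL => ? _; exact: measurable_funM.
move=> x; rewrite !exprMn ler_wpM2r ?sqr_ge0//.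
by rewrite -(real_normK (num_real (f x))) ler_sqr ?nnegrE// (le_trans _ (fC x)).
Qed.

Lemma integral_sqrD_orthogonal f g : sq_integrable f -> sq_integrable g ->
  (\int[Q]_x (f x * g x)%:E = 0)%E ->
  (\int[Q]_x ((f x + g x) ^+ 2)%:E =
   \int[Q]_x (f x ^+ 2)%:E + \int[Q]_x (g x ^+ 2)%:E)%E.
Proof.
move=> fL gL fg0.
transitivity (\int[Q]_x ((f x ^+ 2)%:E + ((g x ^+ 2)%:E + 2%:E * (f x * g x)%:E)))%E.
  apply: eq_integral => x _; rewrite -EFinM -!EFinD; congr EFin; ring.
have ifg := sq_integrableM fL gL.
have i2 := sq_integrableP fL; have i3 := sq_integrableP gL.
have i4 : Q.-integrable setT (fun x => 2%:E * (f x * g x)%:E)%E.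
  exact: integrableZl.
rewrite integralD//; last exact: integrableD.
rewrite integralD// integralZl// fg0 mule0 adde0//.
Qed.

End SquareIntegrable.
(** * First two moments of the centered normal law *)

Section NormalMoments.
Context {R : realType} (s : R).
Hypothesis s0 : s != 0.
Local Notation N := (normal_prob 0 s).

(** The density is even and Lebesgue measure is invariant under negation. *)
Let normal_probN A : measurable A -> pushforward N (-%R : _ -> measurableTypeR R) A = N A.
Proof.
move=> mA; rewrite /pushforward /normal_prob.
have mpdf : measurable_fun setT (fun x : R => (normal_pdf 0 s x)%:E).
  by apply/measurable_EFinP; exact: measurable_normal_pdf.
transitivity (\int[pushforward lebesgue_measure (-%R : R -> measurableTypeR R)]_(x in A)
   (normal_pdf 0 s x)%:E)%E.
  rewrite ge0_integral_pushforward//.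
  - apply: eq_integral => x _; rewrite /= normal_pdfE// /normal_fun.
    by rewrite !subr0 sqrrN.
  - exact: measurable_funTS.
  - by move=> x _; rewrite lee_fin normal_pdf_ge0.
by apply: eq_measure_integral => B mB _; exact: lebesgue_measureN.
Qed.

(** Finiteness suffices, so the variance is not computed: with
    [u = x^2 / (4 s^2)] one has [u <= exp u], and [x^2] times the density of
    variance [s^2] is at most a constant times the density of variance [2 s^2]. *)
Lemma normal_prob_sq_integrable : sq_integrable N id.
Proof.
split; first exact: measurable_id.
rewrite (@ge0_integral_density _ _ _ lebesgue_measure N (normal_pdf 0 s))//.
- pose c := normal_peak s * (4 * s ^+ 2) / normal_peak (s * Num.sqrt 2).
  have s20 : s * Num.sqrt 2 != 0 by rewrite mulf_neq0// gt_eqF// sqrtr_gt0.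
  have := integrable_lty measurableT
    (integrableZl measurableT c (integrable_normal_pdf 0 (s * Num.sqrt 2))).
  apply: le_lt_trans; apply: ge0_le_integral => //.
  + by move=> x _; rewrite mule_ge0// lee_fin ?sqr_ge0 ?normal_pdf_ge0.
  + apply: emeasurable_funM; apply/measurable_EFinP.
      exact: measurable_funX.
    exact: measurable_normal_pdf.
  + by apply: measurable_funeM; apply/measurable_EFinP; exact: measurable_normal_pdf.
  move=> x _; rewrite -!EFinM lee_fin !normal_pdfE// /normal_fun !subr0.
  have -> : c * (normal_peak (s * Num.sqrt 2) *
      expR (- x ^+ 2 / ((s * Num.sqrt 2) ^+ 2 *+ 2))) =
      normal_peak s * ((4 * s ^+ 2) *
        expR (- x ^+ 2 / ((s * Num.sqrt 2) ^+ 2 *+ 2))).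
    rewrite /c; field.
    by rewrite gt_eqF// normal_peak_gt0.
  rewrite [leLHS]mulrCA; apply: ler_wpM2l; first exact: normal_peak_ge0.
  rewrite exprMn sqr_sqrtr//.
  pose u := x ^+ 2 / (4 * s ^+ 2).
  have -> : - x ^+ 2 / (s ^+ 2 *+ 2) = - u + - u by rewrite /u; field.
  have -> : - x ^+ 2 / (s ^+ 2 * 2 *+ 2) = - u by rewrite /u; field.
  have -> : x ^+ 2 = 4 * s ^+ 2 * u by rewrite /u; field.
  have ue : u * expR (- u) <= 1.
    rewrite expRN ler_pdivrMr ?expR_gt0// mul1r.
    by apply: le_trans (expR_ge1Dx u); rewrite lerDr.
  rewrite expRD (_ : _ * (_ * _) = 4 * s ^+ 2 * (u * expR (- u) * expR (- u))).
    apply: ler_wpM2l; first by rewrite mulr_ge0 ?sqr_ge0.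
    by rewrite ler_piMl ?expR_ge0.
  ring.
- exact: integrable_normal_pdf.
- by apply/measurable_EFinP; exact: measurable_funX.
- by move=> x; rewrite lee_fin sqr_ge0.
Qed.

(** By symmetry of the law the mean equals its own opposite. *)
Lemma normal_prob_mean : (\int[N]_x x%:E = 0)%E.
Proof.
have iN : N.-integrable setT (EFin : R -> \bar R).
  exact: sq_integrable_integrable normal_prob_sq_integrable.
have iNN : N.-integrable setT ((EFin : R -> \bar R) \o (-%R)).
  by have := integrableN iN.
have mE : measurable_fun setT (EFin : R -> \bar R) by [].
have E1 : (\int[N]_x x%:E = - \int[N]_x x%:E)%E.
  transitivity (\int[pushforward N (-%R : _ -> measurableTypeR R)]_x (x : R)%:E)%E.
    by apply: eq_measure_integral => A mA _; exact/esym/normal_probN.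
  rewrite integral_pushforward// -integralN//.
  exact: integrable_add_def iN.
have :=  integrable_fin_num measurableT iN.
move: E1; case: (\int[N]_x x%:E)%E => // r [r2] _; congr EFin; lra.
Qed.

End NormalMoments.

(** * Borel maps *)

Section BorelMaps.
Context {R : realType} {d : measure_display} {T : measurableType d}.

Lemma borel_preimage {E E' : topologicalType} (phi : E -> E') (B : set E') :
  (forall A, open A -> borel (phi @^-1` A)) -> borel B -> borel (phi @^-1` B).
Proof.
move=> cphi; move: B.
suff : @borel E' `<=` [set A | borel (phi @^-1` A)] by apply.
apply: smallest_sub => //.
have [b0 bC bU] := smallest_sigma_algebra [set: E] open.
split.
- by rewrite /= preimage_set0.
- move=> A /= bA; rewrite setTD preimage_setC -setTD; exact: bC.
- by move=> A bA /=; rewrite preimage_bigcup; exact: bU.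
Qed.

Lemma measurable_wrt_comp {E E' : topologicalType} (G : set_system T)
    (X : T -> E) (phi : E -> E') :
  continuous phi -> measurable_wrt G X -> measurable_wrt G (phi \o X).
Proof.
move=> cphi mX B bB; rewrite comp_preimage; apply: mX; apply: borel_preimage bB.
by move=> A oA; apply: sub_sigma_algebra; move/continuousP: cphi; apply.
Qed.

Lemma measurable_wrt_coord {n} (G : set_system T) (X : T -> 'cV[R]_n) i :
  measurable_wrt G X -> measurable_wrt G (fun w => X w i 0).
Proof.
by move=> mX; apply: (measurable_wrt_comp (@coord_continuous _ _ _ i 0) mX).
Qed.

Lemma sigma_algebra_sigma_gen {E : topologicalType} (X : T -> E) :
  sigma_algebra setT (sigma_gen X).
Proof.
exact/sigma_algebra_preimage/smallest_sigma_algebra.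
Qed.

Lemma measurable_wrt_sigma_gen {E : topologicalType} (X : T -> E) :
  measurable_wrt (sigma_gen X) X.
Proof. by move=> B bB; exists B => //; rewrite setTI. Qed.

Lemma measurable_wrt_sub {E : topologicalType} (G G' : set_system T)
    (X : T -> E) : G `<=` G' -> measurable_wrt G X -> measurable_wrt G' X.
Proof. by move=> GG' mX B /mX /GG'. Qed.

Lemma sigma_gen_sub {E : topologicalType} (G : set_system T) (X : T -> E) :
  measurable_wrt G X -> sigma_gen X `<=` G.
Proof. by move=> mX A [B bB <-]; rewrite setTI; exact: mX. Qed.

End BorelMaps.

(** * Increments of a Brownian motion *)

Section BrownianIncrement.
Context {R : realType} {d : measure_display} {T : measurableType d} {n : nat}.
Variables (Q : probability T R) (F : R -> set_system T) (a b : R).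
Variable W : R -> T -> 'cV[R]_n.
Hypothesis bW : brownian_on Q F a b W.
Hypothesis sF : forall s, a <= s <= b -> sigma_algebra setT (F s).
Hypothesis FT : forall s, a <= s <= b -> F s `<=` measurable.
Variables (r s : R) (i : 'I_n).
Hypotheses (ar : a <= r) (rs : r < s) (sb : s <= b).

Let D (w : T) : R := W s w i 0 - W r w i 0.

Let Ir : a <= r <= b.
Proof. by rewrite ar (le_trans (ltW rs)). Qed.

Let Is : a <= s <= b.
Proof. by rewrite sb (le_trans ar (ltW rs)). Qed.

Let mD : measurable_fun setT (D : T -> measurableTypeR R).
Proof.
have mW x : a <= x <= b -> measurable_fun setT ((fun w => W x w i 0) : T -> measurableTypeR R).
  move=> Ix; apply: (measurable_wrt_fun (FT Ix)).
  by apply: measurable_wrt_coord; case: bW => + _ _ _; exact.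
by apply: measurable_funB; exact: mW.
Qed.

Let D_law B : measurable B ->
  pushforward Q (D : T -> measurableTypeR R) B = normal_prob 0 (Num.sqrt (s - r)) B.
Proof.
move=> mB; have [_ _ _ law] := bW.
pose Bi (j : 'I_n) := if j == i then B else setT.
have := law r s ar rs sb Bi; rewrite (bigD1 i)//= /Bi eqxx.
rewrite big1 ?mule1 => [<- //|j /negPf ->]; last exact: probability_setT.
- congr (Q _); apply/seteqP; split=> w /=.
    by move=> DB j; case: eqVneq => [->|//]; rewrite /D !mxE in DB *.
  by move=> /(_ i); rewrite eqxx !mxE.
- by move=> j; case: eqVneq.
Qed.

Let s0 : Num.sqrt (s - r) != 0.
Proof. by rewrite gt_eqF// sqrtr_gt0 subr_gt0. Qed.

Lemma brownian_increment_sq_integrable : sq_integrable Q D.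
Proof.
split => //; have [_] := normal_prob_sq_integrable s0; apply: le_lt_trans.
rewrite [leRHS](_ : _ =
    \int[pushforward Q (D : T -> measurableTypeR R)]_x (x ^+ 2)%:E)%E; last first.
  by apply: eq_measure_integral => A mA _; exact/esym/D_law.
rewrite ge0_integral_pushforward//.
- by apply/measurable_EFinP; exact: measurable_funX.
- by move=> x _; rewrite lee_fin sqr_ge0.
Qed.

Let iD := sq_integrable_integrable brownian_increment_sq_integrable.

Lemma brownian_increment_mean : (\int[Q]_w (D w)%:E = 0)%E.
Proof.
rewrite -[RHS](normal_prob_mean s0).
rewrite [RHS](_ : _ =
    \int[pushforward Q (D : T -> measurableTypeR R)]_x (x : R)%:E)%E; last first.
  by apply: eq_measure_integral => A mA _; exact/esym/D_law.
by rewrite integral_pushforward.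
Qed.

(** Independence makes the centered indicator of [A] integrate to zero over every
    set of the sigma-algebra generated by the increment [D]; hence so does its
    product with [D], which is [D] integrated over [A] up to the zero mean. *)
Let increment_centered A : F r A -> (\int[Q]_(w in A) (D w)%:E = 0)%E.
Proof.
move=> FA; have mA := FT Ir FA.
pose c := fine (Q A).
have QA : Q A = c%:E by rewrite fineK ?fin_num_measure.
pose N w : R := \1_A w - c.
have NL : sq_integrable Q N.
  apply: sq_integrableB; last exact: sq_integrable_cst.
  exact: sq_integrable_indic.
have GD : sigma_gen D `<=` measurable.
  by move=> _ [B + <-]; rewrite borel_realE => mB; exact: mD.
have N0 B : sigma_gen D B -> (\int[Q]_(w in B) (N w)%:E = 0)%E.
  move=> sB; have mB := GD _ sB; case: sB => B' bB' BE.
  have indepB : (Q (A `&` B) = Q A * Q B)%E.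
    have [_ _ indep _] := bW.
    have := indep r s ar rs sb A [set x : 'cV[R]_n | B' (x i 0)] FA.
    have -> : [set w | [set x : 'cV[R]_n | B' (x i 0)] (W s w - W r w)%R] = B.
      by rewrite -BE setTI; apply/seteqP; split=> w /=; rewrite !mxE.
    apply; apply: (borel_preimage _ bB') => C oC; apply: sub_sigma_algebra.
    by have /continuousP := @coord_continuous R n 1 i 0; apply.
  under eq_integral do rewrite /N EFinB.
  rewrite integralB//.
  - rewrite integral_indic// integral_cst//. rewrite [X in (X - _)%E]indepB QA.
    by rewrite subee// fin_numM// fin_num_measure.
  - apply: (integrableS measurableT) => //.
    exact: integrable_indic.
  - apply: (integrableS measurableT) => //.
    exact: finite_measure_integrable_cst.
have := integral_mul_centered (sigma_algebra_sigma_gen D) GD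
  (sq_integrable_integrable NL) N0 (measurable_wrt_sigma_gen D)
  (sq_integrableM brownian_increment_sq_integrable NL).
have DN w : (D w * N w)%:E = ((D w * \1_A w)%:E - c%:E * (D w)%:E)%E.
  by rewrite -EFinM -EFinB; congr EFin; rewrite /N; ring.
have DAE : (fun w => (D w * \1_A w)%:E) = (EFin \o D) \_ A.
  apply/funext => w; rewrite indicE patchE; case: (w \in A).
    by rewrite mulr1.
  by rewrite mulr0.
under eq_integral do rewrite DN.
rewrite integralB//.
- rewrite integralZl// brownian_increment_mean mule0 sube0 DAE.
  by rewrite -integral_mkcond.
- by rewrite DAE -integrable_mkcond//; exact: integrableS iD.
- exact: integrableZl.
Qed.

Lemma brownian_increment_orthogonal (xi : T -> R) :
  measurable_wrt (F r) xi -> sq_integrable Q xi ->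
  (\int[Q]_w (xi w * D w)%:E = 0)%E.
Proof.
move=> mxi xiL; apply: (integral_mul_centered (sF Ir) (FT Ir) iD) => //.
exact: sq_integrableM brownian_increment_sq_integrable.
Qed.

End BrownianIncrement.
(** * Integrals of simple processes *)

Section StochasticSum.
Context {R : realType} {d : measure_display} {T : measurableType d} {n : nat}.
Variables (Q : probability T R) (F : R -> set_system T) (h t tau : R).
Variable W : R -> T -> 'cV[R]_n.
Hypotheses (t0 : 0 <= t) (ttau : t <= tau) (tauh : tau <= h).
Hypothesis bW : brownian_on Q F t tau W.
Hypothesis sF : forall s, 0 <= s <= h -> sigma_algebra setT (F s).
Hypothesis Fmono : forall r s, 0 <= r -> r <= s -> s <= h -> F r `<=` F s.
Hypothesis FT : F tau `<=` measurable.

(** Only the part of the integral over [[t, tau]] matters, so the partition is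
    projected onto that interval. *)
Let clip (x : R) : R := Num.max t (Num.min tau x).

Let clip_ge x : t <= clip x.
Proof. by rewrite /clip le_max lexx. Qed.

Let clip_le x : clip x <= tau.
Proof. by rewrite /clip ge_max ttau ge_min lexx. Qed.

Let clip_mono u v : u <= v -> clip u <= clip v.
Proof.
move=> uv; rewrite /clip ge_max le_max lexx/= le_max; apply/orP; right.
by rewrite le_min !ge_min lexx uv orbT.
Qed.

(** A partition interval that does not collapse under the projection starts no
    later than its projection, so its coefficient is known by then. *)
Let clip_lt_ge u v : clip u < clip v -> u <= clip u.
Proof.
rewrite /clip => uv; rewrite le_max; apply/orP; right.
rewrite le_min lexx andbT leNgt; apply/negP => tauu; move: uv.
rewrite (min_idPl (ltW tauu)) (max_idPr ttau) ltNge ge_max ttau/=.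
by rewrite ge_min lexx.
Qed.

Let clip_increment (x : R) w :
  W (Num.min tau x) w - W (Num.min t x) w = W (clip x) w - W t w.
Proof.
rewrite /clip; have /orP[xt|tx] := le_total x t.
  rewrite (min_idPr xt) (min_idPr (le_trans xt ttau)) (max_idPl xt).
  by rewrite !subrr.
by rewrite (min_idPl tx) (max_idPr _)// le_min ttau.
Qed.

Let Itau s : t <= s <= tau -> 0 <= s <= h.
Proof.
by move=> /andP[ts stau]; rewrite (le_trans t0 ts) (le_trans stau).
Qed.

Let term (coef : T -> R) (u v : R) (i : 'I_n) (w : T) : R :=
  coef w * (W (clip v) w i 0 - W (clip u) w i 0).

(** Either the interval collapses and the term vanishes, or the coefficient is
    measurable at the start of the projected interval and can be absorbed into
    [xi], which leaves a Brownian increment. *)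
Let term_spec (C : R) (coef : T -> R) (u v : R) (i : 'I_n) :
  0 <= u -> u <= v -> measurable_wrt (F u) coef -> (forall w, `|coef w| <= C) ->
  sq_integrable Q (term coef u v i) /\
  forall xi, measurable_wrt (F t) xi -> sq_integrable Q xi ->
    (\int[Q]_w (xi w * term coef u v i w)%:E = 0)%E.
Proof.
move=> u0 uv mcoef coefC.
have FtT s : t <= s <= tau -> F s `<=` measurable.
  move=> /andP[ts stau]; apply: subset_trans FT; apply: Fmono => //.
  exact: le_trans ts.
have sFt s : t <= s <= tau -> sigma_algebra setT (F s).
  by move=> /Itau; exact: sF.
have [cuv|] := ltP (clip u) (clip v); last first.
  move=> cvu; have cuv : clip u = clip v.
    by apply/eqP; rewrite eq_le cvu clip_mono.
  have term0 : term coef u v i = cst 0.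
    by apply/funext => w; rewrite /term cuv subrr mulr0.
  rewrite term0; split; first exact: sq_integrable_cst.
  by move=> xi _ _; under eq_integral do rewrite mulr0; rewrite integral0.
have mcoef' : measurable_wrt (F (clip u)) coef.
  apply: measurable_wrt_sub mcoef; apply: Fmono => //; first exact: clip_lt_ge cuv.
  exact: le_trans (clip_le _) tauh.
have Iu : t <= clip u <= tau by rewrite clip_ge clip_le.
have mcoefT : measurable_fun setT (coef : T -> measurableTypeR R).
  exact: measurable_wrt_fun (FtT _ Iu) mcoef'.
have DL := brownian_increment_sq_integrable bW FtT i (clip_ge u) cuv (clip_le v).
split; first exact: sq_integrable_bdM mcoefT coefC DL.
move=> xi mxi xiL.
under eq_integral do rewrite mulrA.
apply: (brownian_increment_orthogonal bW sFt FtT) => //.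
- apply/(measurable_wrtP _ (sFt _ Iu)); apply: measurable_funM.
    apply/(measurable_wrtP _ (sFt _ Iu)); apply: measurable_wrt_sub mxi.
    by apply: Fmono => //; exact: le_trans (clip_le _) tauh.
  exact/(measurable_wrtP _ (sFt _ Iu)).
- under eq_fun do rewrite mulrC.
  exact: sq_integrable_bdM mcoefT coefC xiL.
Qed.

Variables (N : nat) (time : nat -> R) (coef : nat -> T -> 'cV[R]_n).
Hypothesis time_range : forall k, (k <= N)%N -> 0 <= time k <= h.
Hypothesis time_mono : forall k, (k < N)%N -> time k <= time k.+1.
Hypothesis coef_meas : forall k, (k < N)%N -> measurable_wrt (F (time k)) (coef k).
Hypothesis coef_bnd : exists C, forall k w, (k < N)%N -> `|coef k w| <= C.

(** The integral of a simple process, with its data as separate variables: the type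
    of simple processes is tied to the ambient measurable space, while the sums
    are to be integrated on the coarser space of time [tau]. *)
Let S (s : R) (w : T) : R := \sum_(k < N)
  dotv (coef k w) (W (Num.min s (time k.+1)) w - W (Num.min s (time k)) w).

Let incrementE (w : T) : S tau w - S t w = \sum_(k < N) \sum_(i < n)
  term (fun w => coef k w i 0) (time k) (time k.+1) i w.
Proof.
rewrite /S -sumrB; apply: eq_bigr => k _; rewrite /dotv -sumrB.
apply: eq_bigr => i _; rewrite -mulrBr /term; congr (_ * _).
have := clip_increment (time k.+1) w; have := clip_increment (time k) w.
move=> /matrixP/(_ i 0) + /matrixP/(_ i 0); rewrite !mxE; lra.
Qed.

Let coef_term_spec (k : 'I_N) (i : 'I_n) :
  let X := term (fun w => coef k w i 0) (time k) (time k.+1) i in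
  sq_integrable Q X /\
  forall xi, measurable_wrt (F t) xi -> sq_integrable Q xi ->
    (\int[Q]_w (xi w * X w)%:E = 0)%E.
Proof.
have [C coefC] := coef_bnd; apply: (term_spec (C := C)).
- by have /andP[] := time_range (ltnW (ltn_ord k)).
- exact: (time_mono (ltn_ord k)).
- exact: (measurable_wrt_coord i (coef_meas (ltn_ord k))).
- move=> w; apply: le_trans (coefC _ w (ltn_ord k)).
  rewrite [leRHS](mx_normrE (coef k w) : `|coef k w| = _).
  exact: (le_bigmax _ (fun ij => `|coef k w ij.1 ij.2|) (i, 0)).
Qed.

Lemma stochastic_sum_sq_integrable :
  sq_integrable Q (fun w => S tau w - S t w).
Proof.
under eq_fun do rewrite incrementE.
apply: sq_integrable_sum => k; apply: sq_integrable_sum => i.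
exact: (coef_term_spec k i).1.
Qed.

Lemma stochastic_sum_orthogonal (xi : T -> R) :
  measurable_wrt (F t) xi -> sq_integrable Q xi ->
  (\int[Q]_w (xi w * (S tau w - S t w))%:E = 0)%E.
Proof.
move=> mxi xiL; under eq_integral do rewrite incrementE mulr_sumr.
under eq_integral do rewrite -sumEFin.
have XL k i := (coef_term_spec k i).1.
rewrite integral_sum//; last first.
  by move=> k; apply: sq_integrableM => //; exact: sq_integrable_sum.
apply: big1 => k _; under eq_integral do rewrite mulr_sumr -sumEFin.
rewrite integral_sum//; last by move=> i; exact: sq_integrableM.
by apply: big1 => i _; exact: (coef_term_spec k i).2.
Qed.

End StochasticSum.

(** * Orthogonality in the mean-square limit *)

Section MeanSquareLimit.
Context {R : realType} {d : measure_display} {T : measurableType d}.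
Variables (Q : probability T R) (S : nat -> T -> R) (N : T -> R).
Hypothesis SL : forall k, sq_integrable Q (S k).
Hypothesis mN : measurable_fun setT N.
Hypothesis SN : forall e : R, 0 < e -> exists k,
  (\int[Q]_w ((S k w - N w) ^+ 2)%:E < e%:E)%E.

Let SNL (k : nat) (e : R) : (\int[Q]_w ((S k w - N w) ^+ 2)%:E < e%:E)%E ->
  sq_integrable Q (fun w => S k w - N w).
Proof.
move=> ke; split; last by rewrite (lt_trans ke)// ltry.
by apply: measurable_funB => //; case: (SL k).
Qed.

Lemma mean_square_limit_sq_integrable : sq_integrable Q N.
Proof.
have [k /SNL kL] := SN ltr01; have := sq_integrableB (SL k) kL.
by under eq_fun do rewrite opprB addrC subrK.
Qed.

(** For every [c] the second moment of [c * xi - (S k - N)] is nonnegative; since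
    [S k] is orthogonal to [xi], it tends to [c^2 * A + 2 * c * r] with [A] the
    second moment of [xi] and [r] the scalar product of [xi] and [N].  A
    quadratic in [c] without constant term is nonnegative only if [r = 0]. *)
Lemma mean_square_limit_orthogonal (xi : T -> R) : sq_integrable Q xi ->
  (forall k, (\int[Q]_w (xi w * S k w)%:E = 0)%E) ->
  (\int[Q]_w (xi w * N w)%:E = 0)%E.
Proof.
move=> xiL S0; have NL := mean_square_limit_sq_integrable.
have iN := sq_integrableM xiL NL.
have := integrable_fin_num measurableT iN.
have := integrable_fin_num measurableT (sq_integrableP xiL).
case AE : (\int[Q]_w (xi w ^+ 2)%:E)%E => [A| |]// _.
case rE : (\int[Q]_w (xi w * N w)%:E)%E => [r| |]// _.
have A0 : 0 <= A.
  by rewrite -lee_fin -AE; apply: integral_ge0 => w _; rewrite lee_fin sqr_ge0.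
have quad (c : R) : 0 <= c ^+ 2 * A + 2 * c * r.
  apply/ler_addgt0Pr => e /SN[k ke]; have kL := SNL ke.
  rewrite -lee_fin; apply: (@le_trans _ _ (\int[Q]_w
      ((c * xi w - (S k w - N w)) ^+ 2)%:E)%E).
    by apply: integral_ge0 => w _; rewrite lee_fin sqr_ge0.
  rewrite EFinD; apply: le_trans (leeD (lexx _) (ltW ke)).
  rewrite (_ : (fun w => ((c * xi w - (S k w - N w)) ^+ 2)%:E) = fun w =>
     ((c ^+ 2)%:E * (xi w ^+ 2)%:E + ((2 * c)%:E * (xi w * N w)%:E +
     ((- 2 * c)%:E * (xi w * S k w)%:E + ((S k w - N w) ^+ 2)%:E)))%E); last first.
    by apply/funext => w; rewrite -!EFinM -!EFinD; congr EFin; ring.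
  have i1 := integrableZl measurableT (c ^+ 2) (sq_integrableP xiL).
  have i2 := integrableZl measurableT (2 * c) iN.
  have i3 := integrableZl measurableT (- 2 * c) (sq_integrableM xiL (SL k)).
  have i4 := sq_integrableP kL.
  have i34 := integrableD measurableT i3 i4.
  have i234 := integrableD measurableT i2 i34.
  rewrite integralD// integralD// integralD// !integralZl//;
    [|exact: sq_integrableM|exact: sq_integrableP].
  by rewrite S0 AE rE mule0 add0e EFinD !EFinM addeA.
have A1 : A + 1 != 0 by rewrite gt_eqF// ltr_wpDl.
(* The denominator is [A + 1] rather than [A], which may vanish. *)
have := quad (- r / (A + 1)).
have -> : (- r / (A + 1)) ^+ 2 * A + 2 * (- r / (A + 1)) * r =
    - (r ^+ 2 * (A + 2) / (A + 1) ^+ 2) by field.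
rewrite oppr_ge0 pmulr_lle0 ?invr_gt0 ?exprn_even_gt0// pmulr_lle0; last first.
  by rewrite ltr_wpDl.
move=> r2; congr EFin; apply/eqP; rewrite -sqrf_eq0; apply/eqP/le_anti.
by rewrite r2 sqr_ge0.
Qed.

End MeanSquareLimit.

(** * Restriction to a sub-sigma-algebra *)

Section Restriction.
Context {R : realType} {d : measure_display} {T : measurableType d}.
Variables (P : probability T R) (G : set_system T).
Variable PG : probability (g_sigma_algebraType G) R.
Hypotheses (sG : sigma_algebra setT G) (GT : G `<=` measurable).
Hypothesis PGE : forall A, G A -> PG A = P A.

(** The restricted measure is the image of [P] under the identity, seen as a map
    onto the coarser measurable space. *)
Lemma ge0_integral_restriction (f : T -> \bar R) :
  measurable_fun setT (f : g_sigma_algebraType G -> \bar R) ->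
  (forall x, 0 <= f x)%E ->
  (\int[PG]_x f x = \int[P]_x f x)%E.
Proof.
move=> mf f0.
have mid : measurable_fun setT (id : T -> g_sigma_algebraType G).
  move=> _ A mA; rewrite setTI; apply: GT.
  by rewrite -[X in X _](sigma_algebra_id sG).
transitivity (\int[pushforward P (id : T -> g_sigma_algebraType G)]_x f x)%E.
  apply: eq_measure_integral => A mA _; apply: PGE.
  by rewrite -[X in X _](sigma_algebra_id sG).
by rewrite ge0_integral_pushforward.
Qed.

End Restriction.

(** The integral of a nonnegative function is a supremum over the simple functions
    below it, which makes monotonicity available for a bound such as a supremum
    over uncountably many times, whose measurability is unclear. *)
Lemma ge0_le_integralT {R : realType} {d : measure_display}
    {T : measurableType d} (mu : {measure set T -> \bar R}) (f g : T -> \bar R) :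
  (forall x, 0 <= f x)%E -> (forall x, f x <= g x)%E ->
  (\int[mu]_x f x <= \int[mu]_x g x)%E.
Proof.
move=> f0 fg; rewrite !ge0_integralTE//; last first.
  by move=> x; exact: le_trans (fg x).
apply: le_ereal_sup => _ [h hf <-].
by exists h => // x; exact: le_trans (fg x).
Qed.

(** * Conditional expectation and least-squares regression *)

Section ConditionalExpectation.
Context {R : realType} {d : measure_display} {T : measurableType d}.
Context {E : topologicalType}.
Variables (Q : probability T R) (X : T -> E).
Hypothesis XT : sigma_gen X `<=` measurable.

(** The difference of two versions is centered on the sigma-algebra of [X], and
    multiplying it by its sign, which is measurable there, gives its absolute
    value. *)
Lemma cond_expectation_unique (y C C' : T -> R) :
  cond_expectation Q X y C -> cond_expectation Q X y C' ->
  {ae Q, forall w, C w = C' w}.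
Proof.
move=> [_ iC mC CE] [_ iC' mC' CE'].
have sX := sigma_algebra_sigma_gen X.
pose N w := C w - C' w.
have mN : measurable_wrt (sigma_gen X) N.
  apply/(measurable_wrtP _ sX); apply: measurable_funB.
    exact/(measurable_wrtP _ sX).
  exact/(measurable_wrtP _ sX).
have mNT := measurable_wrt_fun XT mN.
have iN : Q.-integrable setT (EFin \o N).
  have := integrableB measurableT iC iC'; apply: eq_integrable => // w _.
have N0 A : sigma_gen X A -> (\int[Q]_(w in A) (N w)%:E = 0)%E.
  move=> sA; have mA := XT sA.
  under eq_integral do rewrite EFinB.
  have iCA := integrableS measurableT mA (@subsetT _ _) iC.
  have iCA' := integrableS measurableT mA (@subsetT _ _) iC'.
  by rewrite integralB// CE// CE'// subee// -CE'// integrable_fin_num.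
pose sgN w : R := if 0 <= N w then 1 else -1.
have msg : measurable_wrt (sigma_gen X) sgN.
  apply/(measurable_wrtP _ sX); apply: measurable_fun_ifT => //.
  apply: measurable_fun_ler => //; exact/(measurable_wrtP _ sX).
have sgE w : sgN w * N w = `|N w|.
  by rewrite /sgN; case: ger0P => _; rewrite ?mul1r ?mulN1r.
have iabs : Q.-integrable setT (fun w => (sgN w * N w)%:E).
  by under eq_fun do rewrite sgE; exact: integrable_norm.
have := integral_mul_centered sX XT iN N0 msg iabs.
under eq_integral do rewrite sgE.
have mNE : measurable_fun setT (EFin \o N) by exact/measurable_EFinP.
move=> /(ae_eq_integral_abs Q measurableT mNE).
apply: filterS => w /= /(_ I) [] /eqP.
by rewrite subr_eq0 => /eqP.
Qed.
End ConditionalExpectation.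

(** The model is [y = v(X) + N] almost surely, with a noise [N] orthogonal to a
    sigma-algebra [G] for which [X] is measurable. *)
Section Regression.
Context {R : realType} {d : measure_display} {T : measurableType d}.
Context {E : topologicalType}.
Variables (Q : probability T R) (G : set_system T) (X : T -> E).
Variables (v : E -> R) (y N : T -> R).
Hypotheses (sG : sigma_algebra setT G) (GT : G `<=` measurable).
Hypotheses (mX : measurable_wrt G X) (mv : measurable_wrt (@borel E) v).
Hypothesis vL : sq_integrable Q (v \o X).
Hypothesis NL : sq_integrable Q N.
Hypothesis N0 : forall xi : T -> R, measurable_wrt G xi -> sq_integrable Q xi ->
  (\int[Q]_w (xi w * N w)%:E = 0)%E.
Hypothesis my : measurable_fun setT y.
Hypothesis yE : {ae Q, forall w, y w = v (X w) + N w}.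

Let mcompX (phi : E -> R) : measurable_wrt (@borel E) phi ->
  measurable_wrt (sigma_gen X) (phi \o X).
Proof. by move=> mphi B bB; exists (phi @^-1` B); [exact: mphi|rewrite setTI]. Qed.

Let sXG : sigma_gen X `<=` G := sigma_gen_sub mX.

Lemma cond_expectation_regression : cond_expectation Q X y (v \o X).
Proof.
have vNL := sq_integrableD vL NL.
have iv := sq_integrable_integrable vL.
have iN := sq_integrable_integrable NL.
have ivN := sq_integrable_integrable vNL.
have myE : measurable_fun setT (EFin \o y) by exact/measurable_EFinP.
have yae : {ae Q, forall w, setT w -> (v (X w) + N w)%:E = (EFin \o y) w}.
  by apply: filterS yE => w /= ->.
split => //.
- apply/integrableP; split=> //.
  suff -> : (\int[Q]_x `|(EFin \o y) x| = \int[Q]_x `|(v (X x) + N x)%:E|)%E.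
    by have /integrableP[] := ivN.
  apply: ae_eq_integral => //.
  + exact: measurableT_comp.
  + by apply: measurableT_comp => //; exact: measurable_int ivN.
  + by apply: filterS yae => w /(_ I) -> _.
- exact: mcompX.
move=> A sA; have GA := sXG sA; have mA := GT GA.
have -> : (\int[Q]_(w in A) (y w)%:E = \int[Q]_(w in A) (v (X w) + N w)%:E)%E.
  apply: ae_eq_integral => //.
  - exact: measurable_funTS.
  - by apply: measurable_funTS; exact: measurable_int ivN.
  - by apply: filterS yae => w /(_ I) /= -> _.
under [RHS]eq_integral do rewrite EFinD.
have ivA := integrableS measurableT mA (@subsetT _ _) iv.
have iNA := integrableS measurableT mA (@subsetT _ _) iN.
rewrite integralD//.
suff -> : (\int[Q]_(w in A) (N w)%:E = 0)%E by rewrite adde0.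
have mI : measurable_wrt G (\1_A : T -> R).
  apply/(measurable_wrtP _ sG); apply: measurable_indic.
  exact: sub_sigma_algebra.
have IL : sq_integrable Q (\1_A : T -> R) by exact: sq_integrable_indic.
rewrite -(N0 mI IL) integral_mkcond; apply: eq_integral => w _.
by rewrite indicE patchE; case: (w \in A); rewrite ?mul1r ?mul0r.
Qed.

Let J (phi : E -> R) := ('E_Q[(fun w => (y w - phi (X w)) ^+ 2)%R])%E.

Let l2_regressorP (phi : E -> R) : l2_regressors Q X phi ->
  measurable_wrt G (fun w => v (X w) - phi (X w)) /\
  sq_integrable Q (fun w => v (X w) - phi (X w)).
Proof.
move=> [mphi /sq_integrable_Lfun phiL]; split; last exact: sq_integrableB.
apply/(measurable_wrtP _ sG); apply: measurable_funB.
  by apply/(measurable_wrtP _ sG); exact: measurable_wrt_sub (mcompX mv).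
by apply/(measurable_wrtP _ sG); exact: measurable_wrt_sub (mcompX mphi).
Qed.

(** Pythagoras: [v(X) - phi(X)] is [G]-measurable, hence orthogonal to the noise. *)
Lemma regression_loss (phi : E -> R) : l2_regressors Q X phi ->
  (J phi = \int[Q]_w (N w ^+ 2)%:E + \int[Q]_w ((v (X w) - phi (X w)) ^+ 2)%:E)%E.
Proof.
move=> Sphi; have [mg gL] := l2_regressorP Sphi.
rewrite addeC -integral_sqrD_orthogonal//; last exact: N0.
rewrite /J unlock; apply: ae_eq_integral => //.
- apply/measurable_EFinP; apply: measurable_funX; apply: measurable_funB => //.
  by case: Sphi => _ /sq_integrable_Lfun[].
- by apply/measurable_EFinP; apply: measurable_funX; case: (sq_integrableD gL NL).
- by apply: filterS yE => w /= -> _; congr EFin; ring.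
Qed.

Lemma regressor_target : l2_regressors Q X v.
Proof. by split => //; exact/sq_integrable_Lfun. Qed.

Let loss_target : J v = (\int[Q]_w (N w ^+ 2)%:E)%E.
Proof.
rewrite regression_loss; last exact: regressor_target.
under [X in (_ + X)%E]eq_integral do rewrite subrr expr0n.
by rewrite integral0 adde0.
Qed.

Lemma regression_minimizer : is_minimizer (l2_regressors Q X) J v.
Proof.
split=> [|phi Sphi]; first exact: regressor_target.
rewrite loss_target regression_loss// leeDl//.
by apply: integral_ge0 => w _; rewrite lee_fin sqr_ge0.
Qed.

Lemma regression_minimizer_unique (phi : E -> R) :
  is_minimizer (l2_regressors Q X) J phi ->
  {ae Q, forall w, phi (X w) = v (X w)}.
Proof.
move=> [Sphi /(_ _ regressor_target)].
rewrite loss_target regression_loss//.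
have [mg gL] := l2_regressorP Sphi.
have := integrable_fin_num measurableT (sq_integrableP NL).
case: (\int[Q]_w (N w ^+ 2)%:E)%E => // a _.
rewrite -[leRHS]adde0 leeD2lE// => g0.
have {}g0 : (\int[Q]_w `|((v (X w) - phi (X w)) ^+ 2)%:E| = 0)%E.
  apply/eqP; rewrite eq_le integral_ge0// andbT.
  by under eq_integral do rewrite gee0_abs ?lee_fin ?sqr_ge0//.
have mg2 : measurable_fun setT (fun w => ((v (X w) - phi (X w)) ^+ 2)%:E).
  by apply/measurable_EFinP; apply: measurable_funX; case: gL.
have /(ae_eq_integral_abs Q measurableT mg2) := g0.
apply: filterS => w /= /(_ I) [] /eqP.
by rewrite sqrf_eq0 subr_eq0 => /eqP.
Qed.

End Regression.

(** * Densities bounded above and away from zero *)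

Section BoundedDensity.
Context {R : realType} {d : measure_display} {T : measurableType d}.
Variables (P Q : probability T R) (Theta : T -> R) (c C : R).
Hypotheses (mTheta : measurable_fun setT Theta) (c0 : 0 < c).
Hypothesis Theta_bnd : forall w, c <= Theta w <= C.
Hypothesis QE : forall A, measurable A ->
  Q A = (\int[P]_(w in A) (Theta w)%:E)%E.

Let C0 : 0 < C.
Proof.
by have /andP[cT TC] := Theta_bnd point; rewrite (lt_le_trans c0)// (le_trans cT).
Qed.

Let Theta_ge0 w : 0 <= Theta w.
Proof. by have /andP[/(lt_le_trans c0)/ltW] := Theta_bnd w. Qed.

Lemma ge0_integral_bounded_density (f : T -> R) :
  measurable_fun setT f -> (forall w, 0 <= f w) ->
  (\int[Q]_w (f w)%:E = \int[P]_w (Theta w * f w)%:E)%E.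
Proof.
move=> mf f0; rewrite (@ge0_integral_density _ _ _ P Q Theta)//.
- by apply: eq_integral => w _; rewrite -EFinM mulrC.
- apply: sq_integrable_integrable.
  apply: (sq_integrable_le mTheta (sq_integrable_cst P C)) => w.
  by have /andP[_ TC] := Theta_bnd w; rewrite ler_sqr ?nnegrE// ltW.
- exact/measurable_EFinP.
Qed.

Lemma integral_bounded_density_le (f : T -> R) :
  measurable_fun setT f -> (forall w, 0 <= f w) ->
  (\int[Q]_w (f w)%:E <= C%:E * \int[P]_w (f w)%:E)%E.
Proof.
move=> mf f0; rewrite ge0_integral_bounded_density// -ge0_integralZl; [|exact: measurableT|..].
- apply: ge0_le_integral => //.
  + by move=> w _; rewrite lee_fin mulr_ge0.
  + by apply/measurable_EFinP; exact: measurable_funM.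
  + by apply: measurable_funeM; exact/measurable_EFinP.
  by move=> w _; rewrite -EFinM lee_fin ler_wpM2r//; have /andP[] := Theta_bnd w.
- exact/measurable_EFinP.
- by move=> w _; rewrite lee_fin.
- by rewrite lee_fin ltW.
Qed.

Let integral_bounded_density_ge (f : T -> R) :
  measurable_fun setT f -> (forall w, 0 <= f w) ->
  (c%:E * \int[P]_w (f w)%:E <= \int[Q]_w (f w)%:E)%E.
Proof.
move=> mf f0; rewrite ge0_integral_bounded_density// -ge0_integralZl; [|exact: measurableT|..].
- apply: ge0_le_integral => //.
  + by move=> w _; rewrite mule_ge0 ?lee_fin// ltW.
  + by apply: measurable_funeM; exact/measurable_EFinP.
  + by apply/measurable_EFinP; exact: measurable_funM.
  by move=> w _; rewrite -EFinM lee_fin ler_wpM2r//; have /andP[] := Theta_bnd w.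
- exact/measurable_EFinP.
- by move=> w _; rewrite lee_fin.
- by rewrite lee_fin ltW.
Qed.

Lemma sq_integrable_bounded_density (f : T -> R) :
  sq_integrable Q f <-> sq_integrable P f.
Proof.
have fin (a : R) : 0 < a -> forall z : \bar R, (0 <= z)%E -> (a%:E * z < +oo)%E -> (z < +oo)%E.
  move=> a0 [z _ _||]//; first by rewrite ltry.
  by rewrite gt0_muley ?lte_fin.
have f2 (M : probability T R) : (0 <= \int[M]_w (f w ^+ 2)%:E)%E.
  by apply: integral_ge0 => w _; rewrite lee_fin sqr_ge0.
split=> -[mf fL]; split => //; have mf2 := measurable_funX 2 mf.
  apply: (fin c) => //; apply: le_lt_trans fL.
  by apply: integral_bounded_density_ge => // w; exact: sqr_ge0.
apply: le_lt_trans (integral_bounded_density_le mf2 _) _.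
  by move=> w; exact: sqr_ge0.
by rewrite lte_mul_pinfty// lee_fin ltW.
Qed.

Lemma l2_regressors_bounded_density {E : topologicalType} (X : T -> E) :
  l2_regressors P X = l2_regressors Q X.
Proof.
apply/seteqP; split=> phi [mphi /sq_integrable_Lfun phiL]; split => //;
  exact/sq_integrable_Lfun/sq_integrable_bounded_density.
Qed.

Lemma weighted_loss (y g : T -> R) :
  measurable_fun setT y -> measurable_fun setT g ->
  ('E_Q[(fun w => (y w - g w) ^+ 2)%R] =
   'E_P[(fun w => Theta w * (y w - g w) ^+ 2)%R])%E.
Proof.
move=> my mg; rewrite !unlock; apply: ge0_integral_bounded_density.
  by apply: measurable_funX; exact: measurable_funB.
by move=> w; exact: sqr_ge0.
Qed.

End BoundedDensity.

(** A bounded [rho] confines the exponential to an interval with positive ends,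
    and the normalizing constant is then a positive real. *)
Lemma gibbs_weight_bounded {R : realType} {d : measure_display}
    {T : measurableType d} (P : probability T R) (rho : T -> R) (lambda C : R) :
  measurable_fun setT rho -> (forall w, `|rho w| <= C) -> 0 < lambda ->
  measurable_fun setT (gibbs_weight P rho lambda) /\
  exists a b : R, 0 < a /\ forall w, a <= gibbs_weight P rho lambda w <= b.
Proof.
move=> mrho rhoC l0; pose e w := expR (- rho w / lambda).
have me : measurable_fun setT e.
  apply: measurableT_comp => //; apply: measurable_funM => //.
  exact: measurableT_comp.
have e_bnd w : expR (- (C / lambda)) <= e w <= expR (C / lambda).
  rewrite !ler_expR -mulNr !ler_pM2r ?invr_gt0// lerNl opprK lerNl.
  by have := rhoC w; rewrite ler_norml => /andP[-> ->].
have eL : sq_integrable P e.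
  apply: (sq_integrable_le me (sq_integrable_cst P (expR (C / lambda)))) => w.
  by have /andP[_ ?] := e_bnd w; rewrite ler_sqr ?nnegrE ?expR_ge0.
have ie := sq_integrable_integrable eL.
pose Zc := fine ('E_P[e])%E.
have Z0 : 0 < Zc.
  have Ee : 'E_P[e]%E = Zc%:E by rewrite fineK// unlock integrable_fin_num.
  rewrite -lte_fin -Ee unlock.
  apply: (@lt_le_trans _ _ (expR (- (C / lambda)))%:E).
    by rewrite lte_fin expR_gt0.
  rewrite -[leLHS]mule1 -(@probability_setT _ _ _ P) -integral_cst//.
  apply: ge0_le_integral => //.
  - by move=> w _; rewrite lee_fin expR_ge0.
  - exact/measurable_EFinP.
  - by move=> w _; rewrite lee_fin; have /andP[] := e_bnd w.
split.
  by apply: measurable_funM; [exact: me|exact: measurable_cst].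
exists (expR (- (C / lambda)) / Zc), (expR (C / lambda) / Zc); split.
  by rewrite divr_gt0 ?expR_gt0.
by move=> w; rewrite /gibbs_weight !ler_pM2r ?invr_gt0//; exact: e_bnd.
Qed.

(** All negligible sets belong to [G], so measurability for [G] ignores
    modifications on them. *)
Lemma measurable_wrt_ae {R : realType} {d : measure_display}
    {T : measurableType d} {E : topologicalType} (P : probability T R)
    (G : set_system T) (f g : T -> E) :
  sigma_algebra setT G -> (forall A, P.-negligible A -> G A) ->
  {ae P, forall w, f w = g w} -> measurable_wrt G g -> measurable_wrt G f.
Proof.
move=> sG negG fg mg B bB; pose D := ~` [set w | f w = g w].
have -> : f @^-1` B = (g @^-1` B `&` ~` D) `|` (f @^-1` B `&` D).
  apply/seteqP; split=> w.
    move=> Bf; have [fgw|fgw] := pselect (f w = g w); last by right.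
    by left; split; [rewrite /= -fgw|move=> /(_ fgw)].
  by move=> [[Bg /contrapT fgw]|[]//]; rewrite /= fgw.
rewrite -(sigma_algebra_id sG).
apply: (@measurableU _ (g_sigma_algebraType G)); last first.
  by apply: sub_sigma_algebra; apply: negG; exact: negligibleS fg.
apply: (@measurableI _ (g_sigma_algebraType G)).
  by apply: sub_sigma_algebra; exact: mg.
apply: (@measurableC _ (g_sigma_algebraType G)).
by apply: sub_sigma_algebra; exact: negG.
Qed.

(** * Increments of the stochastic integral under the weighted measure *)

Lemma lte_scaled_sum {R : realType} (C a : R) (x y : \bar R) : 0 < C ->
  (x < a%:E -> y < a%:E ->
   C%:E * (2%:E * x + 2%:E * y) < (C * (2 * a + 2 * a) : R)%:E)%E.
Proof.
move=> C0 xa ya.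
suff : (C%:E * (2%:E * x + 2%:E * y) < C%:E * (2%:E * a%:E + 2%:E * a%:E))%E by [].
rewrite lte_pmul2l ?lte_fin//.
by apply: lteD; rewrite lte_pmul2l ?lte_fin.
Qed.

Section ItoIncrement.
Context {R : realType} {d : measure_display} {Omega : measurableType d}.
Context {n : nat}.
Variables (P : probability Omega R) (F : R -> set_system Omega) (T : R).
Variable W : R -> Omega -> 'cV[R]_n.
Hypothesis sF : forall s, 0 <= s <= T -> sigma_algebra setT (F s).
Hypothesis FT : forall s A, 0 <= s <= T -> F s A -> measurable A.
Hypothesis Fmono : forall r s, 0 <= r -> r <= s -> s <= T -> F r `<=` F s.
Hypothesis mW : forall s, 0 <= s <= T -> measurable_wrt (F s) (W s).

(** A term whose interval starts after [s] would involve a coefficient unknown at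
    time [s], but its increment of [W] is zero. *)
Lemma sp_integral_adapted (H : simple_process n F T) s : 0 <= s <= T ->
  measurable_wrt (F s) (sp_integral W H s).
Proof.
move=> Is; have [s0 sT] := andP Is; have sFs := sF Is.
have mWle x : 0 <= x -> x <= s -> measurable_wrt (F s) (W x).
  move=> x0 xs; apply: measurable_wrt_sub (mW _); first exact: Fmono.
  by rewrite x0 (le_trans xs).
apply/(measurable_wrtP _ sFs).
pose term (k : 'I_(sp_size H)) w := dotv (sp_coef H k w)
  (W (Num.min s (sp_time H k.+1)) w - W (Num.min s (sp_time H k)) w).
apply: (@measurable_sum _ (g_sigma_algebraType (F s)) R setT _ _ term) => k.
have /andP[tk0 tkT] := sp_time_range (ltnW (ltn_ord k)).
have /andP[tk10 tk1T] := sp_time_range (ltn_ord k).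
have [tks|stk] := leP (sp_time H k) s; last first.
  rewrite [term k](_ : _ = cst 0)//; apply/funext => w; rewrite /term.
  have stk1 := le_trans (ltW stk) (sp_time_mono (ltn_ord k)).
  rewrite (min_idPl (ltW stk)) (min_idPl stk1) subrr /dotv.
  by apply: big1 => i _; rewrite !mxE mulr0.
have mcoef : measurable_wrt (F s) (sp_coef H k).
  by apply: measurable_wrt_sub (sp_coef_meas (ltn_ord k)); exact: Fmono.
have mincr x : 0 <= x -> measurable_wrt (F s) (W (Num.min s x)).
  by move=> x0; apply: mWle; rewrite ?le_min ?s0// ge_min lexx.
apply: (@measurable_sum _ (g_sigma_algebraType (F s)) R setT _ _
  (fun i w => sp_coef H k w i 0 * (W (Num.min s (sp_time H k.+1)) w -
    W (Num.min s (sp_time H k)) w) i 0)) => i.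
apply: measurable_funM.
  by apply/(measurable_wrtP _ sFs); exact: measurable_wrt_coord.
rewrite [X in measurable_fun _ X](_ : _ = fun w =>
    W (Num.min s (sp_time H k.+1)) w i 0 - W (Num.min s (sp_time H k)) w i 0).
  apply: measurable_funB.
    by apply/(measurable_wrtP _ sFs); apply: measurable_wrt_coord; exact: mincr.
  by apply/(measurable_wrtP _ sFs); apply: measurable_wrt_coord; exact: mincr.
by apply/funext => w; rewrite !mxE.
Qed.

Variables (t tau : R) (Z : R -> Omega -> 'cV[R]_n) (M : R -> Omega -> R).
Hypotheses (t0 : 0 <= t) (ttau : t <= tau) (tauT : tau <= T).
Variables (Ptau Q : probability (g_sigma_algebraType (F tau)) R).
Variables (Theta : Omega -> R) (c C : R).
Hypothesis PtauE : forall A, F tau A -> Ptau A = P A.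
Hypothesis mTheta :
  measurable_fun setT (Theta : g_sigma_algebraType (F tau) -> R).
Hypotheses (c0 : 0 < c) (Theta_bnd : forall w, c <= Theta w <= C).
Hypothesis QE : forall A, F tau A ->
  Q A = (\int[Ptau]_(w in A) (Theta w)%:E)%E.
Hypothesis bW : brownian_on Q F t tau W.
Hypothesis iM : ito_integral P F T W Z M.

Let It : 0 <= t <= T.
Proof. by rewrite t0 (le_trans ttau). Qed.

Let Itau : 0 <= tau <= T.
Proof. by rewrite tauT (le_trans t0). Qed.

Let C0 : 0 < C.
Proof.
by have /andP[cT TC] := Theta_bnd point; rewrite (lt_le_trans c0)// (le_trans cT).
Qed.

Let QE' A : measurable (A : set (g_sigma_algebraType (F tau))) ->
  Q A = (\int[Ptau]_(w in A) (Theta w)%:E)%E.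
Proof.
by rewrite [X in X _ -> _](sigma_algebra_id (sF Itau)); exact: QE.
Qed.

Let FtauT : F tau `<=` @measurable _ (g_sigma_algebraType (F tau)).
Proof. exact: sub_sigma_algebra. Qed.

Let measurable_Omega (s : R) (f : Omega -> R) : 0 <= s <= T ->
  measurable_wrt (F s) f -> measurable_fun setT f.
Proof. by move=> Is; apply: measurable_wrt_fun => A; exact: FT. Qed.

Let measurable_tau (f : Omega -> R) : measurable_wrt (F tau) f ->
  measurable_fun setT (f : g_sigma_algebraType (F tau) -> R).
Proof. by move/(measurable_wrtP f (sF Itau)). Qed.

Let aM s : 0 <= s <= T -> measurable_wrt (F s) (M s).
Proof. by case: iM => _ _ aM _ _; exact: aM. Qed.

Let N w := M tau w - M t w.

Let measurable_incr (A : R -> Omega -> R) :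
  measurable_wrt (F t) (A t) -> measurable_wrt (F tau) (A tau) ->
  measurable_fun setT
    ((fun w => A tau w - A t w) : g_sigma_algebraType (F tau) -> R).
Proof.
move=> mt mtau; apply: measurable_funB; apply: measurable_tau => //.
by apply: measurable_wrt_sub mt; exact: Fmono.
Qed.

Let mN : measurable_fun setT (N : g_sigma_algebraType (F tau) -> R).
Proof. by apply: measurable_incr; exact: aM. Qed.

(** The increment over [[t, tau]] is the difference of the errors at [tau] and at
    [t], whose second moments tend to zero under [P]; passing to [Q] costs the
    factor [C]. *)
Let ito_approximation (H : nat -> simple_process n F T) :
  (forall s, 0 <= s <= T ->
    ('E_P[(fun w => (sp_integral W (H k) s w - M s w) ^+ 2)%R])%E
      @[k --> \oo] --> 0%E) ->
  forall e : R, 0 < e -> exists k,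
  (\int[Q]_w ((sp_integral W (H k) tau w - sp_integral W (H k) t w - N w)
     ^+ 2)%:E < e%:E)%E.
Proof.
(* [(u - v)^2 <= 2 u^2 + 2 v^2] and the density bound [C] give [4 * C * e']. *)
move=> HM e e0; pose e' : R := e / (4 * C).
have e'0 : 0 < e' by rewrite divr_gt0// mulr_gt0.
have small s : 0 <= s <= T -> \forall k \near \oo,
    ('E_P[(fun w => (sp_integral W (H k) s w - M s w) ^+ 2)%R] < e'%:E)%E.
  move=> /HM /(_ [set u | (u < e'%:E)%E]); apply.
  by apply: open_ereal_lt'; rewrite lte_fin.
have [k _ /(_ k (leqnn k))[]] := filterI (small _ It) (small _ Itau).
pose D s w := sp_integral W (H k) s w - M s w.
have mS s : 0 <= s <= T -> measurable_wrt (F s) (sp_integral W (H k) s).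
  exact: sp_integral_adapted.
have mD s : 0 <= s <= T -> measurable_fun setT (D s).
  by move=> Is; apply: measurable_funB; apply: (measurable_Omega Is); [exact: mS|exact: aM].
rewrite !unlock => Dt Dtau; exists k.
have mSN : measurable_fun setT
    ((fun w => sp_integral W (H k) tau w - sp_integral W (H k) t w - N w)
      : g_sigma_algebraType (F tau) -> R).
  by apply: measurable_funB mN; apply: measurable_incr; exact: mS.
apply: (le_lt_trans (integral_bounded_density_le mTheta c0 Theta_bnd QE' _ _)).
- exact: measurable_funX.
- by move=> w; exact: sqr_ge0.
rewrite (ge0_integral_restriction (sF Itau) (fun A => @FT _ A Itau) PtauE); last 2 first.
- by apply/measurable_EFinP; exact: measurable_funX.
- by move=> w; rewrite lee_fin sqr_ge0.
have mD2 s : 0 <= s <= T -> measurable_fun setT (fun w => (2 * D s w ^+ 2)%:E).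
  move=> Is; apply/measurable_EFinP; apply: measurable_funM => //.
  by apply: measurable_funX; exact: mD.
have ID s : 0 <= s <= T ->
    (\int[P]_w (2 * D s w ^+ 2)%:E = 2%:E * \int[P]_w (D s w ^+ 2)%:E)%E.
  move=> Is; under eq_integral do rewrite EFinM.
  rewrite ge0_integralZl_EFin//.
  - by move=> w _; rewrite lee_fin sqr_ge0.
  - by apply/measurable_EFinP; apply: measurable_funX; exact: mD.
apply: (@le_lt_trans _ _ (C%:E * (2%:E * \int[P]_w (D tau w ^+ 2)%:E +
    2%:E * \int[P]_w (D t w ^+ 2)%:E))%E).
  rewrite lee_pmul2l ?lte_fin// -!ID// -ge0_integralD//; last 4 first.
  - by move=> w _; rewrite lee_fin mulr_ge0 ?sqr_ge0.
  - exact: mD2.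
  - by move=> w _; rewrite lee_fin mulr_ge0 ?sqr_ge0.
  - exact: mD2.
  apply: ge0_le_integralT => w; first by rewrite lee_fin sqr_ge0.
  rewrite -EFinD lee_fin.
  rewrite (_ : _ - _ - N w = D tau w - D t w); last by rewrite /D /N; ring.
  move: (D tau w) (D t w) => u v.
  by have := sqr_ge0 (u + v); rewrite sqrrD sqrrB; lra.
have -> : e = C * (2 * e' + 2 * e') by rewrite /e'; field; rewrite gt_eqF.
exact: lte_scaled_sum.
Qed.

Let ito_increment_spec : sq_integrable Q N /\
  forall xi : Omega -> R, measurable_wrt (F t) xi -> sq_integrable Q xi ->
    (\int[Q]_w (xi w * N w)%:E = 0)%E.
Proof.
have [_ _ _ _ [H [_ HM]]] := iM.
have SL k := stochastic_sum_sq_integrable t0 ttau tauT bW sF Fmono FtauT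
  (@sp_time_range _ _ _ _ _ _ (H k)) (@sp_time_mono _ _ _ _ _ _ (H k))
  (@sp_coef_meas _ _ _ _ _ _ (H k)) (@sp_coef_bnd _ _ _ _ _ _ (H k)).
have S0 k := stochastic_sum_orthogonal t0 ttau tauT bW sF Fmono FtauT
  (@sp_time_range _ _ _ _ _ _ (H k)) (@sp_time_mono _ _ _ _ _ _ (H k))
  (@sp_coef_meas _ _ _ _ _ _ (H k)) (@sp_coef_bnd _ _ _ _ _ _ (H k)).
have SN := ito_approximation HM.
split; first exact: mean_square_limit_sq_integrable SL mN SN.
move=> xi mxi xiL; apply: (mean_square_limit_orthogonal SL mN SN xiL) => k.
exact: S0.
Qed.

Lemma ito_increment_sq_integrable : sq_integrable Q N.
Proof. exact: ito_increment_spec.1. Qed.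

(** The approximating sums are orthogonal to [F t] under [Q], where [W] is Brownian,
    and their increments converge to [N] in mean square under [Q] too. *)
Lemma ito_increment_orthogonal (xi : Omega -> R) :
  measurable_wrt (F t) xi -> sq_integrable Q xi ->
  (\int[Q]_w (xi w * N w)%:E = 0)%E.
Proof. exact: ito_increment_spec.2. Qed.

End ItoIncrement.

(** * Decomposition of the regression target *)

Lemma continuous_section {R : realType} {E E' F : topologicalType} (D : set E)
    (f : E * E' -> F) (a : E) : D a ->
  {within [set p : E * E' | D p.1], continuous f} ->
  continuous (fun y => f (a, y)).
Proof.
move=> Da /subspace_continuousP cf y.
apply: cvg_comp (cf (a, y) Da) => A /= nA.
case: nA => -[B1 B2] [/= n1 n2] sub; apply: filterS n2 => y' B2y'.
exact: (sub (a, y') (conj (nbhs_singleton n1) B2y') Da).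
Qed.

Section BackwardIncrement.
Context {R : realType} {d : measure_display} {Omega : measurableType d}.
Context {n m : nat} (pb : control_problem R n m).
Variables (P : probability Omega R) (F : R -> set_system Omega).
Variables (W : R -> Omega -> 'cV[R]_n) (V : R -> 'cV[R]_n -> R).
Variables (K X : R -> Omega -> 'cV[R]_n) (Y : R -> Omega -> R).
Variables (Z : R -> Omega -> 'cV[R]_n) (M : R -> Omega -> R) (t tau : R).
Let T := horizon pb.

(** The terminal cost and the integral of the driver over [[tau, T]] cancel when the
    backward equation at [tau] is subtracted from the one at [t]. *)
Lemma Yhat_increment : 0 <= t -> t <= tau -> tau <= T ->
  {ae P, forall w, lebesgue_measure.-integrable `[0, T]
     (fun s => (driver pb V K X Z s w)%:E)} ->
  {ae P, forall w, forall s, 0 <= s <= T ->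
     Y s w = terminal_cost pb (X T w)
             + \int[lebesgue_measure]_(r in `[s, T]) driver pb V K X Z r w
             - (M T w - M s w)} ->
  {ae P, forall w,
     Yhat pb V K X Y Z t tau w = Y t w + (M tau w - M t w)}.
Proof.
move=> t0 ttau tauT; apply: filterS2 => w idr YE.
have It : 0 <= t <= T by rewrite t0 (le_trans ttau).
have Itau : 0 <= tau <= T by rewrite tauT (le_trans t0).
rewrite /Yhat (YE _ It) (YE _ Itau).
have itT : lebesgue_measure.-integrable `[t, T]
    (EFin \o (fun s => driver pb V K X Z s w)).
  apply: integrableS idr => //; apply: subset_itvr.
  by rewrite bnd_simp.
have := Rintegral_itvB itT (x := tau).
rewrite !bnd_simp => /(_ ttau tauT).
rewrite Rintegral_itv_obnd_cbnd; last first.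
  apply: integrableS itT => //; apply: subset_itvr.
  by rewrite bnd_simp.
lra.
Qed.

End BackwardIncrement.

(** * The regression characterization of the value function *)

Theorem mainTheorem2 (R : realType) (d : measure_display)
    (Omega : measurableType d) (n m : nat) (pb : control_problem R n m)
    (P : probability Omega R) (F : R -> set_system Omega)
    (W : R -> Omega -> 'cV[R]_n) (V : R -> 'cV[R]_n -> R)
    (x0 : 'cV[R]_n) (K X : R -> Omega -> 'cV[R]_n)
    (Y : R -> Omega -> R) (Z : R -> Omega -> 'cV[R]_n)
    (t tau : R) (rho : Omega -> R) (lambda : R)
    (Ptau Rtau : probability (g_sigma_algebraType (F tau)) R) :
  well_formed pb ->
  complete_filtration P (horizon pb) F ->
  standard_brownian P F (horizon pb) W ->
  data_regularity pb -> hmu_regularity pb -> classical_solution pb V ->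
  progressive F (horizon pb) K ->
  unique_forward_solution pb P F W x0 K X ->
  novikov pb P K X ->
  backward_solution pb P F W V K X Y Z ->
  feynman_kac pb P V X Y Z ->
  0 <= t -> t <= tau -> tau <= horizon pb ->
  (forall A, F tau A -> Ptau A = P A) ->
  measurable_wrt (F tau) rho -> (exists C : R, forall w, `|rho w| <= C) ->
  0 < lambda ->
  let Theta := gibbs_weight Ptau rho lambda in
  (forall A, F tau A -> Rtau A = (\int[Ptau]_(w in A) (Theta w)%:E)%E) ->
  brownian_on Rtau F t tau W ->
  let Yh := Yhat pb V K X Y Z t tau in
  let Vt w := V t (X t w) in
  let JR phi := ('E_Rtau[(fun w => (Yh w - phi (X t w)) ^+ 2)%R])%E in
  let JP phi := ('E_Ptau[(fun w => Theta w * (Yh w - phi (X t w)) ^+ 2)%R])%E in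
  let SR := l2_regressors Rtau (X t) in
  let SP := l2_regressors Ptau (X t) in
  [/\ cond_expectation Rtau (X t) Yh Vt,
      (forall C, cond_expectation Rtau (X t) Yh C ->
         {ae Rtau, forall w, Y t w = C w /\ C w = Vt w}),
      ereal_inf [set JR phi | phi in SR] = ereal_inf [set JP phi | phi in SP],
      is_minimizer SR JR (V t) /\ is_minimizer SP JP (V t)
    & (forall phi, is_minimizer SR JR phi \/ is_minimizer SP JP phi ->
         {ae Rtau, forall w, phi (X t w) = Vt w})].
Proof.
move=> _ [_ sF FT Fmono Fneg] [[mW _ _ _] _] _ _ [Vder [_ _ [cV _ _ _] _ _]] _.
move=> [[aX _ _ _ _] _] _ [aY _ Y2 idr [M [iM YE]]] [YV _] t0 ttau tauT PtauE.
move=> mrho [C rhoC] l0 Theta QE bW Yh Vt JR JP SR SP.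
set T := horizon pb in sF FT Fmono mW tauT cV aX aY Y2 iM YE YV idr.
have It : 0 <= t <= T by rewrite t0 (le_trans ttau).
have Itau : 0 <= tau <= T by rewrite tauT (le_trans t0).
have FtFtau : F t `<=` F tau by exact: Fmono.
have Ftau_meas : F tau `<=` @measurable _ (g_sigma_algebraType (F tau)).
  exact: sub_sigma_algebra.
have Ft_meas := subset_trans FtFtau Ftau_meas.
have measE : @measurable _ (g_sigma_algebraType (F tau)) = F tau.
  exact: sigma_algebra_id (sF _ Itau).
have QE' A : measurable (A : set (g_sigma_algebraType (F tau))) ->
    Rtau A = (\int[Ptau]_(w in A) (Theta w)%:E)%E.
  by rewrite measE; exact: QE.
have [mTheta [c [b [c0 Theta_bnd]]]] :=
  gibbs_weight_bounded Ptau ((measurable_wrtP rho (sF _ Itau)).1 mrho) rhoC l0.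
have negl_tau A : P.-negligible A -> F tau A.
  by move=> /Fneg; apply: Fmono => //; exact: le_trans ttau.
have aeR (phi : Omega -> Prop) : {ae P, forall w, phi w} -> {ae Rtau, forall w, phi w}.
  move=> Pphi; have Fphi := negl_tau _ Pphi.
  have mphi : measurable (~` phi : set (g_sigma_algebraType (F tau))).
    exact: Ftau_meas.
  have P0 : P (~` phi) = 0%E by apply: measure_negligible => //; exact: FT Itau Fphi.
  have R0 : Rtau (~` phi) = 0%E.
    rewrite QE//; apply: null_set_integral => //; last by rewrite -P0 -PtauE.
    by apply/measurable_EFinP; exact: measurable_funTS.
  by apply/negligibleP.
pose N w := M tau w - M t w.
have YhE : {ae P, forall w, Yh w = V t (X t w) + N w}.
  have := Yhat_increment t0 ttau tauT idr YE.
  by apply: filterS2 YV => w /(_ t It) YtE; rewrite /Yh => ->; rewrite YtE.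
have NL : sq_integrable Rtau N.
  exact: (ito_increment_sq_integrable sF FT Fmono mW t0 ttau tauT PtauE mTheta
    c0 Theta_bnd QE bW iM).
have N0 (xi : Omega -> R) : measurable_wrt (F t) xi -> sq_integrable Rtau xi ->
    (\int[Rtau]_w (xi w * N w)%:E = 0)%E.
  exact: (ito_increment_orthogonal sF FT Fmono mW t0 ttau tauT PtauE mTheta
    c0 Theta_bnd QE bW iM).
have mX : measurable_wrt (F t) (X t) by exact: aX.
have mV : measurable_wrt (@borel _) (V t).
  move=> B; apply: borel_preimage => A oA; apply: sub_sigma_algebra.
  have cVt : continuous (V t).
    exact: (continuous_section (D := `[0, T]%classic) _ cV).
  by move/continuousP: cVt; apply.
have mVX : measurable_wrt (F t) (V t \o X t).
  by move=> B bB; rewrite comp_preimage; apply: mX; exact: mV.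
(* [V t (X t)] is almost surely [Y t], whose square is bounded by an integrable supremum. *)
have VL : sq_integrable Rtau (V t \o X t).
  apply/(sq_integrable_bounded_density mTheta c0 Theta_bnd QE').
  have mVXtau : measurable_fun setT
      ((V t \o X t) : g_sigma_algebraType (F tau) -> R).
    exact: (@measurable_wrt_fun R _ (g_sigma_algebraType (F tau)) _ _ Ft_meas mVX).
  have mY : measurable_fun setT (Y t).
    by apply: measurable_wrt_fun (aY _ It) => A; exact: FT.
  have mVXO : measurable_fun setT (V t \o X t).
    by apply: measurable_wrt_fun mVX => A; exact: FT.
  split=> //; rewrite (ge0_integral_restriction (sF _ Itau) (fun A => FT _ A Itau) PtauE).
  - rewrite (@ae_eq_integral _ _ _ P setT (fun w => (Y t w ^+ 2)%:E))//.
    + apply: le_lt_trans Y2; apply: ge0_le_integralT => w.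
        by rewrite lee_fin sqr_ge0.
      by apply: ereal_sup_ubound; exists t.
    + by apply/measurable_EFinP; exact: measurable_funX.
    + by apply/measurable_EFinP; exact: measurable_funX.
    + by apply: filterS YV => w /(_ t It) -> _.
  - by apply/measurable_EFinP; exact: measurable_funX.
  - by move=> w; rewrite lee_fin sqr_ge0.
(* A pathwise integral of the driver, but almost surely equal to [V t (X t) + N]. *)
have mYh : measurable_fun setT (Yh : g_sigma_algebraType (F tau) -> R).
  apply/(measurable_wrtP _ (sF _ Itau)).
  apply: (measurable_wrt_ae (sF _ Itau) negl_tau YhE).
  apply/(measurable_wrtP _ (sF _ Itau)); apply: measurable_funD.
    exact: (@measurable_wrt_fun R _ (g_sigma_algebraType (F tau)) _ _ Ft_meas mVX).
  by case: NL.
have YhER := aeR _ YhE.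
have XT := subset_trans (sigma_gen_sub mX) Ft_meas.
have CE := cond_expectation_regression (T := g_sigma_algebraType (F tau))
  (sF _ It) Ft_meas mX mV VL NL N0 mYh YhER.
have minV : is_minimizer SR JR (V t).
  exact: (regression_minimizer (T := g_sigma_algebraType (F tau))
    (sF _ It) mX mV VL NL N0 mYh YhER).
have minV_unique phi : is_minimizer SR JR phi ->
    {ae Rtau, forall w, phi (X t w) = Vt w}.
  exact: (regression_minimizer_unique (T := g_sigma_algebraType (F tau))
    (sF _ It) mX mV VL NL N0 mYh YhER).
have SE : SP = SR.
  exact: (l2_regressors_bounded_density mTheta c0 Theta_bnd QE').
have JE phi : SR phi -> JR phi = JP phi.
  move=> [_ /sq_integrable_Lfun[mphi _]].
  exact: (weighted_loss mTheta c0 Theta_bnd QE').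
have minE phi : is_minimizer SP JP phi <-> is_minimizer SR JR phi.
  rewrite SE; split=> -[Sphi min]; split=> // psi Spsi.
    by rewrite !JE//; exact: min.
  by rewrite -!JE//; exact: min.
split.
- exact: CE.
- move=> C' CE'; have CV := cond_expectation_unique
    (T := g_sigma_algebraType (F tau)) XT CE' CE.
  have ae_filter := ae_filter_ringOfSetsType Rtau.
  apply: (@filterS2 _ _ ae_filter _ _ _ _ (aeR _ YV) CV) => w /(_ t It) -> -> //.
- by rewrite SE; congr ereal_inf; apply: eq_imagel.
- by split=> //; exact/minE.
- by move=> phi [/minV_unique|/minE/minV_unique].
Qed.
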